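(* Let $A,B\in \mathrm{BARI}^{\mathrm{pol}}_{\underline{il},swap}$. Then $preuri(A,B)$ is swap invariant up to depth $3$, i.e. for $d=1,2,3$ the depth $d$ components of $swap\big(preuri(A,B)\big)$ and of $preuri(A,B)$ coincide.
   Context: **Bimoulds.** Fix a commutative $\mathbb{Q}$-algebra $R$. A polynomial bimould is a sequence $M=(M_d)_{d\ge 0}$ with $M_d=M_d\binom{u_1,\ldots,u_d}{v_1,\ldots,v_d}\in R[u_1,v_1,\ldots,u_d,v_d]$. Put $w_i=\binom{u_i}{v_i}$, $w=(w_1,\ldots,w_d)$; the index $d$ is often omitted. $\mathrm{BARI}^{\mathrm{pol}}$ is the space of polynomial bimoulds with $M_0=0$ and only finitely many nonzero components. **Swap.** $swap(M)\binom{u_1,\ldots,u_d}{v_1,\ldots,v_d}=M\binom{v_d,\,v_{d-1}-v_d,\ldots,\,v_1-v_2}{u_1+\cdots+u_d,\,u_1+\cdots+u_{d-1},\ldots,\,u_1}$; $M$ is swap invariant if $swap(M)=M$. **Alternil.** $M\in \mathrm{BARI}^{\mathrm{pol}}$ is alternil if, writing $M_d=\sum \varphi(y_{k_1,m_1}\cdots y_{k_d,m_d})\frac{u_1^{m_1}}{m_1!}v_1^{k_1-1}\cdots\frac{u_d^{m_d}}{m_d!}v_d^{k_d-1}$ (sum over $k_i\ge1$, $m_i\ge0$) with a $\mathbb{Q}$-linear map $\varphi:\mathbb{Q}\langle y_{k,m}\mid k\ge1,m\ge0\rangle\to R$, one has $\varphi(x*y)=0$ for all nonempty words $x,y$, where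 $*$ is the stuffle product: $1*x=x*1=x$ and $y_{k_1,m_1}x*y_{k_2,m_2}y=y_{k_1,m_1}(x*y_{k_2,m_2}y)+y_{k_2,m_2}(y_{k_1,m_1}x*y)+y_{k_1+k_2,m_1+m_2}(x*y)$. $\mathrm{BARI}^{\mathrm{pol}}_{\underline{il},swap}$ is the space of alternil, swap invariant $A\in \mathrm{BARI}^{\mathrm{pol}}$ with $A_1$ even, i.e. $A_1\binom{-u_1}{-v_1}=A_1\binom{u_1}{v_1}$. **Flexions, mu, arit.** For $w=abc$: $\lceil c$ is $c$ with the sum of all $u$'s of $b$ added to the first $u$ of $c$; $a\rceil$ is $a$ with the sum of all $u$'s of $b$ added to the last $u$ of $a$; $b\rfloor$ is $b$ with the first $v$ of $c$ subtracted from every $v$ of $b$; $\lfloor b$ is $b$ with the last $v$ of $a$ subtracted from every $v$ of $b$ (nothing is changed if the relevant neighbouring block is empty). Set $mu(A,B)(w_1,\ldots,w_d)=\sum_{j=0}^d A(w_1,\ldots,w_j)B(w_{j+1},\ldots,w_d)$ and $$arit(B)(A)(w)=\sum_{w=abc,\ b,c\ne\emptyset}A(a\lceil c)B(b\rfloor)-\sum_{w=abc,\ a,b\neq\emptyset}A(a\rceil c)B(\lfloor b).$$ **urit and preuri.** For $B\in \mathrm{BARI}^{\mathrm{pol}}$, $urit(B)$ is the unique derivation for the product $mu$ on $\mathrm{BARI}^{\mathrm{pol}}$ (which is generated under $mu$ by bimoulds concentrated in depth $1$) whose value on a bimould $A$ concentrated in depth $1$ is, in depth $n$, $$urit(B)(A)\binom{u_1,\ldots,u_n}{v_1,\ldots,v_n}=arit(B)(A)\binom{u_1,\ldots,u_n}{v_1,\ldots,v_n}+\sum_{\substack{d+r+1=n\\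 d,r\ge1}}urit(B)^{(d,r)}(A)\binom{u_1,\ldots,u_n}{v_1,\ldots,v_n},$$ where, with $n=d+r+1$ and $I=\{1,\ldots,r,n\}$, $$urit(B)^{(d,r)}(A)\binom{u_1,\ldots,u_n}{v_1,\ldots,v_n}=A\binom{u_1+\cdots+u_n}{v_1}\Bigg[\sum_{s\in I}\ \prod_{k\in I,\,k\neq s}\frac{1}{v_k-v_s}\,B\binom{u_{r+1},\ldots,u_{d+r}}{v_{r+1}-v_s,\ldots,v_{d+r}-v_s}$$ $$-\sum_{s=1}^{r+1}\ \prod_{\substack{k=1\\k\ne s}}^{r+1}\frac{1}{v_k-v_s}\,B\binom{u_{r+2},\ldots,u_{d+r+1}}{v_{r+2}-v_s,\ldots,v_{d+r+1}-v_s}\Bigg].$$ Finally $preuri(A,B)=urit(B)(A)+mu(A,B)$. *)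

(* Defs.v *)
From HB Require Import structures.
From mathcomp Require Import all_boot all_order all_algebra.
From mathcomp Require Import mpoly.
From mathcomp Require Import ring zify.
From Stdlib Require Import ClassicalEpsilon FunctionalExtensionality.

Set Implicit Arguments.
Unset Strict Implicit.
Unset Printing Implicit Defensive.

Import GRing.Theory Pdiv.Ring Pdiv.RingMonic.
Local Open Scope ring_scope.

Section Bimoulds.
Variable R : comAlgType rat.

(* The variables of M_d are ordered u_1, ..., u_d, v_1, ..., v_d. *)
Definition bimould := forall d : nat, {mpoly R[d + d]}.

Definition bm_add (A B : bimould) : bimould := fun d => A d + B d.
Definition bm_scale (a : R) (A : bimould) : bimould := fun d => a *: A d.

Definition bari (M : bimould) : Prop :=
  M 0%N = 0 /\ exists N : nat, forall d, (N <= d)%N -> M d = 0.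

(* A word is a list of two-row letters, with polynomials as entries; positions
   in a word are counted from 0. *)
Definition word (n : nat) := seq ({mpoly R[n]} * {mpoly R[n]}).

Definition letters (d : nat) : word (d + d) :=
  [seq ('X_(lshift d i), 'X_(rshift d i)) | i <- enum 'I_d].

Definition usub n (w : word n) (i : nat) : {mpoly R[n]} := (nth (0, 0) w i).1.
Definition vsub n (w : word n) (i : nat) : {mpoly R[n]} := (nth (0, 0) w i).2.
Definition usum n (w : word n) : {mpoly R[n]} := \sum_(x <- w) x.1.

(* M(w): the component of depth |w|, evaluated at the letters of w. *)
Definition ev (M : bimould) n (w : word n) : {mpoly R[n]} :=
  mmap (@mpolyC n R)
    (fun k => match split k with inl i => usub w i | inr i => vsub w i end)
    (M (size w)).

(* In position 0, vsub w (size w) = 0, so that the first letter is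
   (v_d, u_1 + ... + u_d). *)
Definition swapw n (w : word n) : word n :=
  [seq (vsub w (size w - i.+1) - vsub w (size w - i),
        usum (take (size w - i) w)) | i <- iota 0 (size w)].

Definition swap (M : bimould) : bimould := fun d => ev M (swapw (letters d)).

Definition mu (A B : bimould) : bimould := fun d =>
  \sum_(0 <= j < d.+1) ev A (take j (letters d)) * ev B (drop j (letters d)).

(* The letter (k, m) stands for y_{k,m}; a word of such letters belongs to
   Q<y_{k,m}> when all k >= 1. *)
Definition ybase (x : seq (nat * nat)) : bool := all (fun y => 0 < y.1)%N x.

(* The terms, with multiplicity, of the stuffle product of two words. *)
Fixpoint stuffle (x : seq (nat * nat)) :=
  fix stuffle_x (y : seq (nat * nat)) : seq (seq (nat * nat)) :=
    match x, y with
    | [::], _ => [:: y]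
    | _, [::] => [:: x]
    | a :: x', b :: y' =>
        [seq a :: z | z <- stuffle x' y] ++ [seq b :: z | z <- stuffle_x y']
        ++ [seq (a.1 + b.1, a.2 + b.2)%N :: z | z <- stuffle x' y']
    end.

(* The exponent of u_1^{m_1} v_1^{k_1 - 1} ... u_d^{m_d} v_d^{k_d - 1}. *)
Definition wmon (d : nat) (x : seq (nat * nat)) : 'X_{1..d + d} :=
  [multinom match split k with
            | inl i => (nth (0, 0) x i).2
            | inr i => (nth (0, 0) x i).1.-1
            end | k < d + d]%N.

(* phi is given by its values on the basis of words. *)
Definition alternil (M : bimould) : Prop :=
  exists phi : seq (nat * nat) -> R,
    (forall x, ybase x ->
       (M (size x))@_(wmon (size x) x)
         = (\prod_(y <- x) (y.2)`!%:R)^-1 *: phi x) /\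
    (forall x y, ybase x -> ybase y -> x != [::] -> y != [::] ->
       \sum_(z <- stuffle x y) phi z = 0).

Definition swap_invariant (M : bimould) : Prop := swap M = M.

Definition even1 (M : bimould) : Prop :=
  ev M [seq (- x.1, - x.2) | x <- letters 1] = M 1%N.

Definition bari_il_swap (M : bimould) : Prop :=
  [/\ bari M, alternil M, swap_invariant M & even1 M].

Definition shiftv n (x : {mpoly R[n]}) (w : word n) : word n :=
  [seq (y.1, y.2 - x) | y <- w].

(* The flexions, for w = abc: uflexl b c and uflexr a b are the u-flexions of c
   and a by b; vflexr b c and vflexl a b are the v-flexions of b by c and a. *)
Definition uflexl n (b c : word n) : word n :=
  if c is x :: c' then (x.1 + usum b, x.2) :: c' else [::].
Definition uflexr n (a b : word n) : word n := rev (uflexl b (rev a)).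
Definition vflexr n (b c : word n) : word n := shiftv (head (0, 0) c).2 b.
Definition vflexl n (a b : word n) : word n := shiftv (last (0, 0) a).2 b.

Definition cuts3 n (w : word n) : seq (word n * word n * word n) :=
  [seq (take i w, take (j - i) (drop i w), drop j w)
     | i <- iota 0 (size w).+1, j <- iota i ((size w).+1 - i)].

Definition arit (B A : bimould) : bimould := fun d =>
  \sum_(abc <- cuts3 (letters d) | (abc.1.2 != [::]) && (abc.2 != [::]))
     (let: (a, b, c) := abc in ev A (a ++ uflexl b c) * ev B (vflexr b c))
  - \sum_(abc <- cuts3 (letters d) | (abc.1.1 != [::]) && (abc.1.2 != [::]))
     (let: (a, b, c) := abc in ev A (uflexr a b ++ c) * ev B (vflexl a b)).

(* Q = \sum_(s <- I) N s * \prod_(k <- I | k != s) (v k - v s)^-1, after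
   multiplication by the common denominator. *)
Definition is_sumfrac n (I : seq nat) (v N : nat -> {mpoly R[n]})
    (Q : {mpoly R[n]}) : Prop :=
  Q * \prod_(t <- I) \prod_(k <- I | k != t) (v k - v t)
  = \sum_(s <- I)
      N s * \prod_(t <- I | t != s) \prod_(k <- I | k != t) (v k - v t).

Definition sumfrac n (I : seq nat) (v N : nat -> {mpoly R[n]}) : {mpoly R[n]} :=
  epsilon (inhabits 0) (is_sumfrac I v N).

(* In terms of positions counted from 0, the set {1, ..., r, n} becomes
   {0, ..., r - 1, d + r}. *)
Definition urit_br (B : bimould) (d r n : nat) : {mpoly R[n + n]} :=
  let w := letters n in
  sumfrac (rcons (iota 0 r) (d + r)) (vsub w)
    (fun s => ev B (shiftv (vsub w s) (take d (drop r w))))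
  - sumfrac (iota 0 r.+1) (vsub w)
      (fun s => ev B (shiftv (vsub w s) (take d (drop r.+1 w)))).

Definition urit_dr (B A : bimould) (d r n : nat) : {mpoly R[n + n]} :=
  ev A [:: (usum (letters n), vsub (letters n) 0)] * urit_br B d r n.

Definition concentrated1 (A : bimould) : Prop := forall d, d != 1%N -> A d = 0.

Record is_urit (B : bimould) (D : bimould -> bimould) : Prop := IsUrit {
  urit_bari : forall A, bari A -> bari (D A);
  urit_linear : forall a A A', bari A -> bari A' ->
    D (bm_add (bm_scale a A) A') = bm_add (bm_scale a (D A)) (D A');
  urit_mu : forall A A', bari A -> bari A' ->
    D (mu A A') = bm_add (mu (D A) A') (mu A (D A'));
  urit_depth1 : forall A, concentrated1 A -> forall n,
    D A n = arit B A n
      + \sum_(1 <= d < n) \sum_(1 <= r < n | (d + r + 1 == n)%N)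
          urit_dr B A d r n
}.

(* For B in BARI, such a D exists (uritP) and is unique on BARI (urit_ext). *)
Definition urit (B : bimould) : bimould -> bimould :=
  epsilon (inhabits id) (is_urit B).

Definition preuri (A B : bimould) : bimould := bm_add (urit B A) (mu A B).

End Bimoulds.

Section Evaluation.
Variable R : comAlgType rat.
Local Notation bimould := (bimould R).
Local Notation word := (word R).

Definition mapw n m (f : {mpoly R[n]} -> {mpoly R[m]}) (w : word n) : word m :=
  [seq (f x.1, f x.2) | x <- w].

Definition hw n (w : word n) d : 'I_(d + d) -> {mpoly R[n]} :=
  fun k => match split k with inl i => usub w i | inr i => vsub w i end.

Definition sbt n m (h : 'I_n -> {mpoly R[m]}) : {mpoly R[n]} -> {mpoly R[m]} :=
  mmap (@mpolyC m R) h.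
HB.instance Definition _ n m h := GRing.RMorphism.copy (@sbt n m h) (mmap (@mpolyC m R) h).

Lemma evE (M : bimould) n (w : word n) d : size w = d ->
  ev M w = sbt (@hw n w d) (M d).
Proof. by move=> <-. Qed.

Lemma sbt_comp n m p (h : 'I_n -> {mpoly R[m]}) (g : 'I_m -> {mpoly R[p]}) x :
  sbt g (sbt h x) = sbt (sbt g \o h) x.
Proof.
rewrite {2}/sbt /mmap rmorph_sum /=; apply: eq_bigr => k _.
rewrite rmorphM /= {1}/sbt mmapC; congr (_ * _).
by rewrite /mmap1 rmorph_prod; apply: eq_bigr => i _; rewrite rmorphXn.
Qed.

Lemma eq_sbt n m (h g : 'I_n -> {mpoly R[m]}) x : h =1 g -> sbt h x = sbt g x.
Proof. by move=> e; apply: eq_bigr => k _; rewrite (mmap1_eq _ e). Qed.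

Lemma usub_map n m (h : 'I_n -> {mpoly R[m]}) w i :
  usub (mapw (sbt h) w) i = sbt h (usub w i).
Proof.
rewrite /usub; have [l|l] := ltnP i (size w).
  by rewrite (nth_map (0,0)).
by rewrite !nth_default ?size_map //= rmorph0.
Qed.
Lemma vsub_map n m (h : 'I_n -> {mpoly R[m]}) w i :
  vsub (mapw (sbt h) w) i = sbt h (vsub w i).
Proof.
rewrite /vsub; have [l|l] := ltnP i (size w).
  by rewrite (nth_map (0,0)).
by rewrite !nth_default ?size_map //= rmorph0.
Qed.
Lemma usum_map n m (h : 'I_n -> {mpoly R[m]}) w :
  usum (mapw (sbt h) w) = sbt h (usum w).
Proof. by rewrite /usum big_map rmorph_sum. Qed.

Lemma ev_map (M : bimould) n m (h : 'I_n -> {mpoly R[m]}) w :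
  ev M (mapw (sbt h) w) = sbt h (ev M w).
Proof.
rewrite (@evE M _ _ (size w)) ?size_map // (@evE M _ w (size w)) // sbt_comp.
apply: eq_sbt => k /=; rewrite /hw; case: (split k) => i; [exact: usub_map|exact: vsub_map].
Qed.

Lemma size_letters d : size (letters R d) = d.
Proof. by rewrite size_map size_enum_ord. Qed.

Lemma usub_letters d (i : 'I_d) : usub (letters R d) i = 'X_(lshift d i).
Proof. by rewrite /usub (nth_map i) ?size_enum_ord // nth_ord_enum. Qed.
Lemma vsub_letters d (i : 'I_d) : vsub (letters R d) i = 'X_(rshift d i).
Proof. by rewrite /vsub (nth_map i) ?size_enum_ord // nth_ord_enum. Qed.

Lemma ev_letters M d : ev M (letters R d) = M d.
Proof.
rewrite (evE _ (size_letters d)) -[RHS]comp_mpoly_id /comp_mpoly.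
apply: eq_sbt => k; rewrite tnth_mktuple /hw.
by case: (split_ordP k) => i ->; rewrite ?usub_letters ?vsub_letters.
Qed.

Lemma map_letters n (w : word n) d : size w = d ->
  mapw (sbt (@hw n w d)) (letters R d) = w.
Proof.
move=> <-; apply: (@eq_from_nth _ (0,0)); first by rewrite size_map size_letters.
rewrite size_map size_letters => i li.
pose j := Ordinal li; have := usub_map (@hw n w (size w)) (letters R (size w)) j.
have := vsub_map (@hw n w (size w)) (letters R (size w)) j.
rewrite usub_letters vsub_letters /sbt !mmapX !mmap1U /hw.
rewrite -/(unsplit (inl j)) -/(unsplit (inr j)) !unsplitK /= /usub /vsub.
by case: (nth _ (mapw _ _) _) => a b /= -> ->; case: (nth _ _ _).
Qed.

Lemma ev_nat (N : bimould) (G : forall n, word n -> {mpoly R[n]}) :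
  (forall d, N d = G _ (letters R d)) ->
  (forall n m (h : 'I_n -> {mpoly R[m]}) w, G _ (mapw (sbt h) w) = sbt h (G _ w)) ->
  forall n (w : word n), ev N w = G _ w.
Proof.
move=> e nat n w; rewrite (@evE N _ w (size w)) // e -nat map_letters //.
Qed.

Lemma ev_mu A B n (w : word n) : ev (mu A B) w =
  \sum_(0 <= j < (size w).+1) ev A (take j w) * ev B (drop j w).
Proof.
pose G n (w : word n) := \sum_(0 <= j < (size w).+1) ev A (take j w) * ev B (drop j w).
apply: (@ev_nat _ G).
  by move=> d; rewrite /G size_letters.
move=> n' m h w'; rewrite /G size_map rmorph_sum; apply: eq_bigr => j _.
by rewrite rmorphM /= -!ev_map /mapw map_take map_drop.
Qed.
End Evaluation.

(* Lagrange interpolation: Q is, up to sign, the coefficient of degree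
   size I - 1 of f modulo \prod_k ('X - x k). *)
Lemma divdiff_idomain (D : idomainType) (I : seq nat) (x : nat -> D) (f : {poly D}) :
  uniq I -> {in I &, injective x} ->
  exists Q, ((size f < size I)%N -> Q = 0) /\ Q * \prod_(t <- I) \prod_(k <- I | k != t) (x k - x t) =
    \sum_(s <- I) f.[x s] * \prod_(t <- I | t != s) \prod_(k <- I | k != t) (x k - x t).
Proof.
move=> uI xI.
case: (posnP (size I)) => [/size0nil->|sI]; first by exists 0; rewrite !big_nil mul0r; split.
pose P := \prod_(k <- I) ('X - (x k)%:P).
have Pm : P \is monic by apply: monic_prod => k _; exact: monicXsubC.
have sP : size P = (size I).+1 by rewrite /P size_prod_XsubC.
pose g := rmodp f P.
have sg : (size g < size P)%N by apply: ltn_rmodpN0; exact: monic_neq0.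
pose r := (size I).-1.
pose W s := \prod_(t <- I | t != s) \prod_(k <- I | k != t) (x k - x t).
pose L s := \prod_(k <- I | k != s) ('X - (x k)%:P).
have szL s : s \in I -> size (L s) = size I.
  move=> sIn; rewrite /L -big_filter size_prod_XsubC size_filter.
  have := count_predC (pred1 s) I; rewrite count_uniq_mem // sIn => <-.
  by rewrite add1n.
have mL s : L s \is monic by apply: monic_prod => k _; exact: monicXsubC.
pose Dl := \prod_(t <- I) \prod_(k <- I | k != t) (x k - x t).
have DlW s : s \in I -> Dl = W s * ((-1) ^+ r * (L s).[x s]).
  move=> sIn; rewrite /Dl (bigD1_seq s) //= mulrC; congr (_ * _).
  rewrite /L horner_prod.
  have -> : r = size [seq k <- I | k != s] .
    by have := szL s sIn; rewrite /L -big_filter size_prod_XsubC /r => <-.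
  rewrite -[in RHS]big_filter -big_filter.
  elim: [seq k <- I | k != s] => [|k l IH]; first by rewrite !big_nil mulr1.
  by rewrite !big_cons IH /= exprS hornerXsubC; ring.
pose h := Dl *: g - \sum_(s <- I) (f.[x s] * W s * (-1) ^+ r) *: L s.
have h0 : h = 0.
  apply: (@roots_geq_poly_eq0 _ h [seq x s | s <- I]).
  - apply/allP => _ /mapP [t tI ->]; rewrite /root /h !hornerE /= horner_sum.
    rewrite (bigD1_seq t) //= big1_seq ?addr0; last first.
      move=> s /andP [st sIn]; rewrite hornerZ /L horner_prod. rewrite -big_filter (bigD1_seq t) ?filter_uniq //=; last by rewrite mem_filter eq_sym st.
      by rewrite hornerXsubC subrr mul0r mulr0.
    rewrite hornerZ (DlW _ tI).
    have -> : g.[x t] = f.[x t].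
      rewrite [in RHS](rdivp_eq Pm f) hornerD hornerM.
      suff -> : P.[x t] = 0 by rewrite mulr0 add0r.
      by rewrite /P horner_prod (bigD1_seq t) //= hornerXsubC subrr mul0r.
    by apply/eqP; ring.
  - by rewrite map_inj_in_uniq.
  - rewrite size_map; apply: (leq_trans (size_polyD _ _)); rewrite geq_max size_polyN; apply/andP; split.
      by apply: (leq_trans (size_scale_leq _ _)); rewrite -ltnS -sP.
    apply: (leq_trans (size_sum _ _ _)).
    apply/bigmax_leqP_seq => s sIn _.
    by apply: (leq_trans (size_scale_leq _ _)); rewrite szL.
have := congr1 (fun p : {poly D} => p`_r) h0.
rewrite /h coefB coefZ coef_sum coef0 => /eqP; rewrite subr_eq0 => /eqP e.
exists ((-1) ^+ r * g`_r); split.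
  move=> sf; rewrite /g rmodp_small ?sP; last exact: leq_trans sf (leqnSn _).
  by rewrite nth_default ?mulr0 // -ltnS /r prednK.
rewrite -/Dl -mulrA [_`_r * _]mulrC e mulr_sumr.
apply: eq_big_seq => s sIn; rewrite coefZ.
have -> : (L s)`_r = 1 by have := mL s; rewrite monicE lead_coefE szL // => /eqP.
rewrite mulr1 mulrC -!mulrA -exprD -signr_odd addnn odd_double expr0 mulr1 //.
Qed.

Lemma divdiff_gen (S : comNzRingType) (I : seq nat) (v : nat -> S) (f : {poly S}) :
  uniq I ->
  exists Q, ((size f < size I)%N -> Q = 0) /\
   Q * \prod_(t <- I) \prod_(k <- I | k != t) (v k - v t) =
    \sum_(s <- I) f.[v s] * \prod_(t <- I | t != s) \prod_(k <- I | k != t) (v k - v t).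
Proof.
move=> uI.
have mono m : exists Q, ((m.+1 < size I)%N -> Q = 0) /\
   Q * \prod_(t <- I) \prod_(k <- I | k != t) (v k - v t) =
    \sum_(s <- I) (v s) ^+ m * \prod_(t <- I | t != s) \prod_(k <- I | k != t) (v k - v t).
  pose N := \max_(i <- I) i.
  pose x (i : nat) : {mpoly int[N.+1]} := 'X_(inord i).
  have xI : {in I &, injective x}.
    move=> i j iI jI /= /(congr1 (fun p : {mpoly int[N.+1]} => p@_U_(inord i))).
    rewrite /x !mcoeffX eqxx; case: eqP => // e _.
    have := congr1 (fun m : 'X_{1..N.+1} => m (inord i)) e.
    rewrite !mnm1E eqxx; case: eqP => // /(congr1 val) /=.
    by rewrite !inordK // ltnS leq_bigmax_seq.
  have [Q [Q0 eQ]] := divdiff_idomain ('X^m) uI xI.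
  pose h (i : 'I_N.+1) : S := v i.
  pose phi : {rmorphism {mpoly int[N.+1]} -> S} := mmap (intr : int -> S) h.
  have phix i : i \in I -> phi (x i) = v i.
    by move=> iI; rewrite /phi /x /= mmapX mmap1U /h inordK // ltnS leq_bigmax_seq.
  move: phi phix => phi phix.
  exists (phi Q); split.
    by move=> l; rewrite Q0 ?size_polyXn // rmorph0.
  have := congr1 phi eQ; rewrite rmorphM /=.
  have inner t : t \in I -> phi (\prod_(k <- I | k != t) (x k - x t)) = \prod_(k <- I | k != t) (v k - v t).
    move=> tI; rewrite rmorph_prod big_seq_cond [in RHS]big_seq_cond.
    by apply: eq_bigr => k /andP [kI _]; rewrite rmorphB /= !phix.
  rewrite rmorph_prod /= (eq_big_seq _ inner) => ->.
  rewrite rmorph_sum; apply: eq_big_seq => s sI.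
  rewrite rmorphM /= hornerXn rmorphXn /= phix //; congr (_ * _).
  rewrite rmorph_prod big_seq_cond [in RHS]big_seq_cond.
  by apply: eq_bigr => k /andP [kI _]; rewrite inner.
have [q Hq] : exists q : nat -> S, forall m, ((m.+1 < size I)%N -> q m = 0) /\
   q m * \prod_(t <- I) \prod_(k <- I | k != t) (v k - v t) =
    \sum_(s <- I) (v s) ^+ m * \prod_(t <- I | t != s) \prod_(k <- I | k != t) (v k - v t).
  by exists (fun m => proj1_sig (constructive_indefinite_description _ (mono m))) => m; case: constructive_indefinite_description.
exists (\sum_(i < size f) f`_i * q i); split.
  move=> l; apply: big1 => i _; rewrite (proj1 (Hq i)) ?mulr0 //.
  by apply: leq_ltn_trans l; exact: ltn_ord.
rewrite mulr_suml.
transitivity (\sum_(i < size f) \sum_(s <- I) f`_i * ((v s) ^+ i * \prod_(t <- I | t != s) \prod_(k <- I | k != t) (v k - v t))).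
  by apply: eq_bigr => i _; rewrite -mulrA (proj2 (Hq i)) mulr_sumr.
rewrite exchange_big; apply: eq_bigr => s _.
by rewrite horner_coef mulr_suml; apply: eq_bigr => i _; rewrite mulrA.
Qed.

Section Fractions.
Variable R : comAlgType rat.

Lemma lregXB n (i j : 'I_n) : i != j -> GRing.lreg ('X_i - 'X_j : {mpoly R[n]}).
Proof.
have nU : i != j -> U_(i)%MM != U_(j)%MM :> 'X_{1..n}.
  move=> ij; apply/negP => /eqP e.
  have := congr1 (fun m : 'X_{1..n} => m i) e.
  by rewrite !mnm1E eqxx eq_sym (negbTE ij).
have H a b : (U_(b)%MM < U_(a)%MM :> 'X_{1..n})%O -> GRing.lreg ('X_a - 'X_b : {mpoly R[n]}).
  move=> ab; apply: lreg_mleadc.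
  have e : mlead ('X_a - 'X_b : {mpoly R[n]}) = U_(a)%MM.
    by rewrite mleadDl ?mleadN !mleadXm.
  rewrite e mcoeffB !mcoeffX eqxx; case: eqP => [e'|_].
    by rewrite e' Order.POrderTheory.ltxx in ab.
  by rewrite subr0; exact: lreg1.
move=> /nU; case: Order.TotalTheory.ltgtP => // l _; last exact: H.
by rewrite -opprB; apply/lregN/H.
Qed.

Lemma lreg_prods n (I : seq nat) : all (fun i => i < n)%N I ->
  GRing.lreg (\prod_(t <- I) \prod_(k <- I | k != t) (vsub (letters R n) k - vsub (letters R n) t)).
Proof.
move=> /allP aI; rewrite big_seq; apply: (big_ind (@GRing.lreg _)); [exact: lreg1|exact: lregM|].
move=> t tI; rewrite big_seq_cond; apply: (big_ind (@GRing.lreg _)); [exact: lreg1|exact: lregM|].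
move=> k /andP [kI kt].
have e i (l : (i < n)%N) : vsub (letters R n) i = 'X_(rshift n (Ordinal l)).
  by rewrite /vsub (nth_map (Ordinal l)) ?size_enum_ord // -[i]/(val (Ordinal l)) nth_ord_enum.
rewrite (e _ (aI _ tI)) (e _ (aI _ kI)); apply: lregXB.
by apply: contraNneq kt => /rshift_inj/(congr1 val) /= ->.
Qed.

Lemma sumfracP (n : nat) I (N : nat -> {mpoly R[n + n]}) (f : {poly {mpoly R[n + n]}}) :
  uniq I -> all (fun i => i < n)%N I ->
  (forall s, s \in I -> N s = f.[vsub (letters R n) s]) ->
  is_sumfrac I (vsub (letters R n)) N (sumfrac I (vsub (letters R n)) N) /\
  ((size f < size I)%N -> sumfrac I (vsub (letters R n)) N = 0).
Proof.
move=> uI aI eN; have [Q [Q0 eQ]] := divdiff_gen (vsub (letters R n)) f uI.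
have HQ : is_sumfrac I (vsub (letters R n)) N Q.
  by rewrite /is_sumfrac eQ; apply: eq_big_seq => s sI; rewrite eN.
have H := epsilon_spec (inhabits 0) _ (ex_intro _ Q HQ).
split=> // sf; rewrite -(Q0 sf); move: (lreg_prods aI) => /(_ (sumfrac I (vsub (letters R n)) N) Q).
by rewrite ![_ * sumfrac _ _ _]mulrC ![_ * Q]mulrC; apply; rewrite HQ -H.
Qed.

Lemma ev_shift_poly (B : bimould R) d : forall n (w : word R n),
  size w = d ->
  exists f : {poly {mpoly R[n]}}, (size f <= (msize (B d)).+1)%N /\ forall x, ev B (shiftv x w) = f.[x].
Proof.
move=> n w sw.
pose h (k : 'I_(d + d)) : {poly {mpoly R[n]}} :=
  match split k with inl i => (usub w i)%:P | inr i => (vsub w i)%:P - 'X end.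
exists (mmap (polyC \o @mpolyC n R) h (B d)); split.
  rewrite /mmap; apply: (leq_trans (size_sum _ _ _)).
  apply/bigmax_leqP_seq => m mB _.
  apply: (leq_trans (size_polyMleq _ _)).
  have: (size ((polyC \o @mpolyC n R) (B d)@_m) <= 1)%N by exact: size_polyC_leq1.
  have: (size (mmap1 h m) <= (mdeg m).+1)%N.
    rewrite /mmap1 mdegE; elim/big_ind2: _ => [|a b c e ha hc|i _].
    - by rewrite size_poly1.
    - by apply: (leq_trans (size_polyMleq _ _)); lia.
    apply: (leq_trans (size_poly_exp_leq _ _)).
    have: (size (h i) <= 2)%N.
      rewrite /h; case: (split i) => j; first by apply: leq_trans (size_polyC_leq1 _) _.
      by rewrite -opprB size_polyN size_XsubC.
    move: (size (h i)) (m i) => a b. move=> ab. rewrite ltnS -[leqRHS]mul1n leq_mul2r. by apply/orP; right; lia.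
  have := msize_mdeg_lt mB.
  by move: (size _) (size _) => a b; lia.
move=> x.
have sz : size (shiftv x w) = d by rewrite size_map.
have -> : ev B (shiftv x w) = mmap (@mpolyC n R)
    (fun k => match split k with inl i => usub (shiftv x w) i | inr i => vsub (shiftv x w) i end) (B d).
  by rewrite /ev; case: _ / sz.
rewrite /mmap horner_sum; apply: eq_bigr => m _; rewrite hornerM hornerC; congr (_ * _).
rewrite /mmap1 horner_prod; apply: eq_bigr => i _; rewrite horner_exp; congr (_ ^+ _).
rewrite /h; case: (split i) => j; rewrite /usub /vsub (nth_map (0,0)) ?sw //= ?hornerC //.
by rewrite hornerD hornerN hornerC hornerX.
Qed.
End Fractions.

Section Insertion.
Variable R : comAlgType rat.
Local Notation bimould := (bimould R).
Local Notation word := (word R).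

Definition blk n (i j : nat) (w : word n) : word n := take (j - i) (drop i w).

Section Dz.
Variable n : nat.
Variables (z : word n -> {mpoly R[n]} * {mpoly R[n]}) (k : word n -> {mpoly R[n]}).

(* One factor b of w = abc is replaced by the letter z b, with weight k b. *)
Definition dz (x : word n -> {mpoly R[n]}) (w : word n) :=
  \sum_(0 <= i < (size w).+1) \sum_(0 <= j < (size w).+1 | (i < j)%N)
    x (take i w ++ z (blk i j w) :: drop j w) * k (blk i j w).

Lemma dz_mu (x y m : word n -> {mpoly R[n]}) (w : word n) :
  (forall w, m w = \sum_(0 <= l < (size w).+1) x (take l w) * y (drop l w)) ->
  dz m w = \sum_(0 <= l < (size w).+1) dz x (take l w) * y (drop l w)
         + \sum_(0 <= l < (size w).+1) x (take l w) * dz y (drop l w).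
Proof.
move=> hm; set N := size w.
pose F i j l := x (take i w ++ z (blk i j w) :: drop j (take l w)) * k (blk i j w) * y (drop l w).
pose G i j l := x (take l w) * y (take (i - l) (drop l w) ++ z (blk i j w) :: drop j w) * k (blk i j w).
have -> : \sum_(0 <= l < N.+1) dz x (take l w) * y (drop l w) =
  \sum_(0 <= l < N.+1) \sum_(0 <= i < N.+1) \sum_(0 <= j < N.+1) if (i < j <= l)%N then F i j l else 0.
  apply: eq_big_nat => l /andP [_ lN].
  have sl : size (take l w) = l by rewrite size_takel.
  rewrite /dz sl mulr_suml [LHS](big_nat_widen _ _ N.+1) // big_mkcond /=.
  apply: eq_big_nat => i _; case: ifP => il; last first.
    by rewrite big1 // => j _; case: ifP => //; lia.
  rewrite mulr_suml [LHS](big_nat_widen _ _ N.+1) // big_mkcond /=.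
  apply: eq_big_nat => j _; rewrite ltnS; case: ifP => // /andP [ij jl].
  have bE : blk i j (take l w) = blk i j w.
    rewrite /blk; have -> : drop i (take l w) = take (l - i) (drop i w) by rewrite take_drop subnK //; lia.
    by rewrite take_takel //; lia.
  have -> : take i (take l w) = take i w by rewrite take_takel; [|lia].
  by rewrite bE.
have -> : \sum_(0 <= l < N.+1) x (take l w) * dz y (drop l w) =
  \sum_(0 <= l < N.+1) \sum_(0 <= i < N.+1) \sum_(0 <= j < N.+1) if (l <= i < j)%N then G i j l else 0.
  apply: eq_big_nat => l /andP [_ lN].
  have sl : (size (drop l w)).+1 = (N.+1 - l)%N by rewrite size_drop subSn.
  rewrite /dz sl mulr_sumr.
  transitivity (\sum_(l <= i < N.+1) \sum_(0 <= j < N.+1) if (i < j)%N then G i j l else 0).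
    rewrite -[l in RHS]add0n big_addn; apply: eq_big_nat => i _.
    rewrite mulr_sumr -big_mkcond /=.
    transitivity (\sum_(l <= j < N.+1 | (i + l < j)%N) G (i + l)%N j l).
      rewrite -[l in RHS]add0n big_addn; apply: eq_big => j; first by rewrite add0n ltn_add2r.
      move=> _; rewrite /G addnK.
      have -> : blk (i + l) (j + l) w = blk i j (drop l w).
        by rewrite /blk subnDr drop_drop.
      by rewrite drop_drop mulrA.
    rewrite (big_nat_widenl _ 0) //.
    by apply: eq_bigl => j; lia.
  rewrite (big_nat_widenl _ 0) // big_mkcond /=; apply: eq_bigr => i _.
  by case: ifP => il; [|rewrite big1].
have ex (f : nat -> nat -> nat -> {mpoly R[n]}) :
    \sum_(0 <= l < N.+1) \sum_(0 <= i < N.+1) \sum_(0 <= j < N.+1) f l i j =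
    \sum_(0 <= i < N.+1) \sum_(0 <= j < N.+1) \sum_(0 <= l < N.+1) f l i j.
  by rewrite exchange_big_nat; apply: eq_bigr => i _; rewrite exchange_big_nat.
rewrite [X in _ = X + _]ex [X in _ = _ + X]ex -big_split /=; apply: eq_big_nat => i /andP [_ iN].
rewrite -big_split /= big_mkcond /=; apply: eq_big_nat => j /andP [_ jN].
case: ifP => ij; last first.
  by rewrite !big1 ?addr0 // => l _; rewrite andbC ?andFb //= andbF.
set u := take i w ++ _.
have su : size u = (i + (N - j).+1)%N by rewrite /u size_cat /= size_takel ?size_drop //; lia.
rewrite hm su mulr_suml.
rewrite (@big_cat_nat _ _ _ i.+1) /=; [|by []|by lia].
rewrite addrC; congr (_ + _).
  transitivity (\sum_(j <= l < N.+1) F i j l).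
    rewrite -[i.+1]add0n -[j in RHS]add0n !big_addn.
    have -> : ((i + (N - j).+1).+1 - i.+1 = N.+1 - j)%N by lia.
    apply: eq_big_nat => t /andP [_ tN]; rewrite /F /u.
    have -> : take (t + i.+1) (take i w ++ z (blk i j w) :: drop j w)
            = take i w ++ z (blk i j w) :: drop j (take (t + j) w).
      rewrite take_cat size_takel ?ifN; [|lia..].
      have -> : (t + i.+1 - i = t.+1)%N by lia.
      by rewrite /= take_drop.
    have -> : drop (t + i.+1) (take i w ++ z (blk i j w) :: drop j w) = drop (t + j) w.
      rewrite drop_cat size_takel ?ifN; [|lia..].
      have -> : (t + i.+1 - i = t.+1)%N by lia.
      by rewrite /= drop_drop.
    by rewrite -!mulrA; congr (_ * _); exact: mulrC.
  by rewrite (big_nat_widenl _ 0) // big_mkcond.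
transitivity (\sum_(0 <= l < i.+1) G i j l).
  apply: eq_big_nat => l /andP [_ li]; rewrite /G /u.
  rewrite takel_cat ?size_takel; [|lia..].
  rewrite take_takel //; congr (_ * _ * _).
  rewrite drop_cat size_takel; [|lia].
  case: (ltnP l i) => l'; first by rewrite take_drop subnK //; lia.
  have -> : l = i by lia.
  by rewrite subnn take0 drop0.
rewrite [LHS](big_nat_widen _ _ N.+1) // [LHS]big_mkcond /=; apply: eq_bigr => l _; by rewrite ltnS andbT.
Qed.
End Dz.
End Insertion.

Section Existence.
Variable R : comAlgType rat.
Local Notation bimould := (bimould R).
Local Notation word := (word R).

Lemma ev0 (M : bimould) n (w : word n) d : size w = d -> M d = 0 -> ev M w = 0.
Proof. by move=> e M0; rewrite (evE _ e) M0 rmorph0. Qed.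

Lemma ev_lin a (A A' : bimould) n (w : word n) :
  ev (bm_add (bm_scale a A) A') w = a *: ev A w + ev A' w.
Proof. by rewrite /ev /bm_add /bm_scale mmapD mmapZ mul_mpolyC. Qed.

(* The fractions in urit_br are polynomials. *)
Lemma sumfrac_evP (B : bimould) m (I : seq nat) (b : word (m + m)) :
  uniq I -> all (fun i => i < m)%N I ->
  let v := vsub (letters R m) in let N s := ev B (shiftv (v s) b) in
  is_sumfrac I v N (sumfrac I v N).
Proof.
move=> uI aI v N; have [f [_ ef]] := ev_shift_poly B (erefl (size b)).
by have [] := @sumfracP _ m I N f uI aI (fun s _ => ef _).
Qed.

Variable B : bimould.
Hypothesis hB : bari B.

Definition Kb : bimould := fun m => \sum_(1 <= d < m) \sum_(1 <= r < m | (d + r + 1 == m)%N) urit_br B d r m.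
Definition Pb : bimould := fun m => let w := letters R m in ev B (shiftv (vsub w m.-1) (take m.-1 w)).
Definition Lb : bimould := fun m => let w := letters R m in Kb m - ev B (shiftv (vsub w 0) (behead w)).

Definition z1 n (b : word n) := (usum b, vsub b (size b).-1).
Definition z2 n (b : word n) := (usum b, vsub b 0).

Definition dw (A : bimould) n (w : word n) :=
  dz (@z1 n) (ev Pb (n := n)) (ev A (n := n)) w + dz (@z2 n) (ev Lb (n := n)) (ev A (n := n)) w.
Definition Dx (A : bimould) : bimould := fun d => dw A (letters R d).

Lemma map_blk n m (f : {mpoly R[n]} -> {mpoly R[m]}) i j (w : word n) :
  blk i j (mapw f w) = mapw f (blk i j w).
Proof. by rewrite /blk /mapw -map_drop -map_take. Qed.

Lemma dz_nat (z : forall n, word n -> {mpoly R[n]} * {mpoly R[n]}) K A n m (h : 'I_n -> {mpoly R[m]}) w :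
  (forall w, z _ (mapw (sbt h) w) = (sbt h (z _ w).1, sbt h (z _ w).2)) ->
  dz (@z m) (ev K (n := m)) (ev A (n := m)) (mapw (sbt h) w)
  = sbt h (dz (@z n) (ev K (n := n)) (ev A (n := n)) w).
Proof.
move=> hz; rewrite /dz size_map rmorph_sum; apply: eq_bigr => i _.
rewrite rmorph_sum; apply: eq_bigr => j _; rewrite rmorphM /= -!ev_map map_blk hz.
by congr (ev A _ * _); rewrite /mapw map_cat /= map_take map_drop.
Qed.

Lemma ev_Dx A n (w : word n) : ev (Dx A) w = dw A w.
Proof.
apply: (@ev_nat _ _ (dw A)) => // n' m h w'.
rewrite /dw rmorphD /=; congr (_ + _); apply: dz_nat => u.
  by rewrite /z1 usum_map vsub_map size_map.
by rewrite /z2 usum_map vsub_map.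
Qed.

Lemma Dx_mu A A' : Dx (mu A A') = bm_add (mu (Dx A) A') (mu A (Dx A')).
Proof.
apply: functional_extensionality_dep => d; rewrite /bm_add /mu {1}/Dx /dw.
have hm w := @ev_mu R A A' (d + d) w.
rewrite (dz_mu _ _ _ hm) (dz_mu _ _ _ hm) size_letters addrACA.
congr (_ + _); rewrite -big_split; apply: eq_bigr => j _; first by rewrite ev_Dx /dw mulrDl.
by rewrite ev_Dx /dw mulrDr.
Qed.

Lemma dz_lin a (A A' : bimould) n z k (w : word n) :
  dz z k (ev (bm_add (bm_scale a A) A') (n := n)) w
  = a *: dz z k (ev A (n := n)) w + dz z k (ev A' (n := n)) w.
Proof.
rewrite /dz scaler_sumr -big_split; apply: eq_bigr => i _ /=.
rewrite scaler_sumr -big_split; apply: eq_bigr => j _ /=.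
by rewrite ev_lin mulrDl scalerAl.
Qed.

Lemma Dx_lin a A A' : Dx (bm_add (bm_scale a A) A') = bm_add (bm_scale a (Dx A)) (Dx A').
Proof.
apply: functional_extensionality_dep => d; rewrite /bm_add /bm_scale /Dx /dw !dz_lin.
by rewrite scalerDr addrACA.
Qed.

Lemma sumfrac_shift_big m (I : seq nat) d (b : word (m + m)) :
  uniq I -> all (fun i => i < m)%N I -> size b = d -> ((msize (B d)).+1 < size I)%N ->
  sumfrac I (vsub (letters R m)) (fun s => ev B (shiftv (vsub (letters R m) s) b)) = 0.
Proof.
move=> uI aI sb sI; have [f [sf ef]] := ev_shift_poly B sb.
have [|_] := @sumfracP _ m I (fun s => ev B (shiftv (vsub (letters R m) s) b)) f uI aI.
  by move=> s _; rewrite ef.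
by apply; apply: leq_ltn_trans sI.
Qed.

Lemma Kb_fin : exists N, forall m, (N <= m)%N -> Kb m = 0.
Proof.
case: hB => _ [N hN].
exists (N + (\max_(d < N) msize (B d)) + 4)%N => m Nm.
rewrite /Kb big_nat_cond; apply: big1 => d /andP [/andP [d1 dm] _].
rewrite big_nat_cond; apply: big1 => r /andP [/andP [r1 rm] /eqP e].
have lr : ((msize (B d)).+1 < r.+1)%N.
  case: (ltnP d N) => dN; last by rewrite hN // msize0; lia.
  have := @leq_bigmax 'I_N (fun d => msize (B d)) (Ordinal dN); rewrite /=.
  move: (\max_(i < N) _) (mmeasure _ _) Nm => a b; lia.
rewrite /urit_br !(sumfrac_shift_big (d := d)) ?subr0 ?size_rcons ?size_iota //.
- by rewrite iota_uniq.
- by apply/allP => i; rewrite mem_iota; lia.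
- by rewrite size_takel // size_drop size_letters; lia.
- by rewrite rcons_uniq iota_uniq mem_iota; lia.
- by apply/allP => i; rewrite mem_rcons inE mem_iota; lia.
- by rewrite size_takel // size_drop size_letters; lia.
Qed.

Lemma dz_fin (K A : bimould) NK NA m (z : word (m + m) -> {mpoly R[m + m]} * {mpoly R[m + m]}) :
  (forall m, (NK <= m)%N -> K m = 0) -> (forall m, (NA <= m)%N -> A m = 0) ->
  (NK + NA <= m)%N -> dz z (ev K (n := _)) (ev A (n := _)) (letters R m) = 0.
Proof.
move=> hK hA l; rewrite /dz size_letters big_nat_cond; apply: big1 => i /andP [/andP [_ im] _].
rewrite big_nat_cond; apply: big1 => j /andP [/andP [_ jm] ij].
have sl : size (letters R m) = m by exact: size_letters.
case: (leqP NK (j - i)) => h.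
  rewrite (@ev0 K _ _ (j - i)) ?mulr0 //; last exact: hK.
  by rewrite /blk size_takel // size_drop sl; lia.
rewrite (@ev0 A _ _ (i + (m - j).+1)) ?mul0r //; last by apply: hA; lia.
by rewrite size_cat /= size_drop sl size_takel // sl; lia.
Qed.

Lemma dz0 n z k x (w : word n) : size w = 0%N -> dz z k x w = 0.
Proof. by rewrite /dz => ->; rewrite big_nat1 big_mkcond big_nat1. Qed.

Lemma Dx_bari A : bari A -> bari (Dx A).
Proof.
move=> [A0 [N hN]]; split.
  by rewrite /Dx /dw !dz0 ?addr0 // size_letters.
case: hB => B0 [NB hNB]; have [NK hNK] := Kb_fin.
exists (NB + NK + N + 2)%N => d hd; rewrite /Dx /dw.
rewrite (@dz_fin _ _ (NB + 1) N) ?(@dz_fin _ _ (NB + NK + 1) N) ?addr0 //; try lia.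
- move=> m hm; rewrite /Lb hNK; last lia.
  rewrite (@ev0 B _ _ m.-1) ?subr0 //; first by rewrite size_map size_behead size_letters.
  by apply: hNB; lia.
- move=> m hm; rewrite /Pb (@ev0 B _ _ m.-1) //.
    by rewrite size_map size_takel // size_letters; lia.
  by apply: hNB; lia.
Qed.

Lemma dz_conc (A : bimould) m (z : word (m + m) -> {mpoly R[m + m]} * {mpoly R[m + m]}) k : concentrated1 A ->
  dz z k (ev A (n := _)) (letters R m) = if (0 < m)%N then ev A [:: z (letters R m)] * k (letters R m) else 0.
Proof.
move=> hA; case: ifP => m0; last by rewrite dz0 // size_letters; lia.
rewrite /dz size_letters.
have H i j : (i < j <= m)%N -> (i + (m - j) != 0)%N ->
   ev A (take i (letters R m) ++ z (blk i j (letters R m)) :: drop j (letters R m)) = 0.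
  move=> ij ne; apply: (@ev0 _ _ _ (i + (m - j)).+1); last by apply: hA; lia.
  by rewrite size_cat /= size_drop size_letters size_takel ?size_letters; lia.
rewrite big_nat_recl // [X in _ + X]big_nat_cond [X in _ + X]big1 ?addr0; last first.
  move=> i /andP [/andP [_ im] _]; rewrite big_nat_cond; apply: big1 => j /andP [/andP [_ jm] ij].
  by rewrite H ?mul0r //; lia.
rewrite big_mkcond big_nat_recr //= m0 [X in X + _]big_nat_cond [X in X + _]big1 ?add0r; last first.
  move=> j /andP [/andP [_ jm] _]; case: ifP => // ij; rewrite H ?mul0r //; lia.
have -> : blk 0 m (letters R m) = letters R m by rewrite /blk subn0 drop0 take_oversize ?size_letters.
by rewrite take0 drop_oversize ?size_letters.
Qed.

Lemma sum_cuts n (w : word n) P (F : word n -> word n -> word n -> {mpoly R[n]}) :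
  \sum_(abc <- cuts3 w | P abc) (let: (a, b, c) := abc in F a b c)
  = \sum_(0 <= i < (size w).+1) \sum_(0 <= j < (size w).+1 | (i <= j)%N)
     if P (take i w, blk i j w, drop j w) then F (take i w) (blk i j w) (drop j w) else 0.
Proof.
rewrite big_mkcond /cuts3 big_allpairs_dep [in RHS]/index_iota subn0.
apply: eq_big_seq => i; rewrite mem_iota => il.
rewrite -[iota i _]/(index_iota i (size w).+1) (big_nat_widenl _ 0) //.
Qed.

Lemma sum_one n i0 j0 (F : nat -> nat -> {mpoly R[n]}) N : (i0 <= j0 < N)%N ->
  (forall i j, (i <= j < N)%N -> (i, j) != (i0, j0) -> F i j = 0) ->
  \sum_(0 <= i < N) \sum_(0 <= j < N | (i <= j)%N) F i j = F i0 j0.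
Proof.
move=> h H; rewrite (bigD1_seq i0) ?iota_uniq ?mem_index_iota //=; last lia.
rewrite [X in _ + X]big1_seq ?addr0; last first.
  move=> i /andP [ii _]; rewrite big_nat_cond; apply: big1 => j /andP [/andP [_ jN] ij].
  by apply: H; [lia | apply: contraNneq ii => -[->]].
rewrite big_mkcond (bigD1_seq j0) ?iota_uniq ?mem_index_iota //=; last lia.
rewrite ifT; last lia.
rewrite big1_seq ?addr0 // => j /andP [jj]; rewrite mem_index_iota => jN.
case: ifP => // ij; apply: H; first lia.
by apply: contraNneq jj => -[->].
Qed.

Lemma size_uflexl n (b c : word n) : size (uflexl b c) = size c.
Proof. by case: c. Qed.
Lemma size_uflexr n (a b : word n) : size (uflexr a b) = size a.
Proof. by rewrite /uflexr size_rev size_uflexl size_rev. Qed.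

Lemma arit_conc A d : concentrated1 A -> (0 < d)%N ->
  arit B A d = dz (@z1 _) (ev Pb (n := _)) (ev A (n := _)) (letters R d)
   - ev A [:: z2 (letters R d)] * ev B (shiftv (vsub (letters R d) 0) (behead (letters R d))).
Proof.
move=> hA d0; rewrite dz_conc // d0 /arit !sum_cuts; set w := letters R d.
have sw : size w = d by exact: size_letters.
have B0 : B 0%N = 0 by case: hB.
have sblk i j : (i <= j <= d)%N -> size (blk i j w) = (j - i)%N.
  by move=> ij; rewrite /blk size_takel // size_drop sw; lia.
rewrite sw; congr (_ - _).
  rewrite (@sum_one _ 0 d.-1) /=; [|lia|].
    rewrite take0 -!size_eq0 size_drop sblk ?sw; last lia.
    have b0 : blk 0 d.-1 w = take d.-1 w by rewrite /blk subn0 drop0.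
    case: ifP => h; last first.
      rewrite [ev Pb _](_ : _ = 0) ?mulr0 // ev_letters /Pb.
      by apply: (@ev0 _ _ _ 0) => //; rewrite size_map size_takel ?size_letters; lia.
    have e : drop d.-1 w = [:: nth (0, 0) w d.-1].
      rewrite (drop_nth (0, 0)) ?sw; last lia.
      by rewrite prednK // drop_oversize ?sw.
    have e1 : [::] ++ uflexl (blk 0 d.-1 w) (drop d.-1 w) = [:: z1 w].
      rewrite b0 e /= /z1 sw; congr [:: (_, _)].
      by rewrite -[in RHS](cat_take_drop d.-1 w) {1}e /usum big_cat big_seq1 addrC.
    have e2 : vflexr (blk 0 d.-1 w) (drop d.-1 w) = shiftv (vsub w d.-1) (take d.-1 w).
      by rewrite b0 e.
    by rewrite e1 e2 (ev_letters Pb d) /Pb.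
  move=> i j ij ne; case: ifP => // /andP [b0 c0].
  rewrite (@ev0 A _ _ (i + (d - j))) ?mul0r //.
    by rewrite size_cat size_uflexl size_drop sw size_takel // sw; lia.
  apply: hA; move: c0; rewrite -size_eq0 size_drop sw => c0.
  apply: contraNneq ne => e; apply/eqP; congr (_, _); lia.
rewrite (@sum_one _ 1 d) /=; [|lia|].
  rewrite -!size_eq0 size_takel ?sw //.
  rewrite sblk; last lia.
  case: ifP => h; last first.
    rewrite [ev B _](_ : _ = 0) ?mulr0 //.
    by apply: (@ev0 _ _ _ 0) => //; rewrite size_map size_behead sw; lia.
  have e : take 1 w = [:: nth (0, 0) w 0].
    by case: (w) sw d0 => [<- //|x l _ _] /=; rewrite take0.
  have e2 : blk 1 d w = behead w.
    by rewrite /blk drop1 take_oversize // size_behead sw; lia.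
  have e3 : uflexr (take 1 w) (blk 1 d w) ++ drop d w = [:: z2 w].
    rewrite e e2 drop_oversize ?sw // cats0 /uflexr /= /z2; congr [:: (_, _)].
    by rewrite -[in RHS](cat_take_drop 1 w) {1}e drop1 /usum big_cat big_seq1.
  have e4 : vflexl (take 1 w) (blk 1 d w) = shiftv (vsub w 0) (behead w).
    by rewrite e e2.
  by rewrite e3 e4.
move=> i j ij ne; case: ifP => // /andP [a0 b0].
rewrite (@ev0 A _ _ (i + (d - j))) ?mul0r //.
  by rewrite size_cat size_uflexr size_drop sw size_takel // sw; lia.
apply: hA; move: a0; rewrite -size_eq0 size_takel ?sw; last lia.
move=> a0; apply: contraNneq ne => e; apply/eqP; congr (_, _); lia.
Qed.

Lemma is_urit_Dx : is_urit B Dx.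
Proof.
split.
- exact: Dx_bari.
- by move=> a A A' _ _; exact: Dx_lin.
- by move=> A A' _ _; exact: Dx_mu.
move=> A hA n; case: (posnP n) => [->|n0].
  rewrite big_geq // addr0 /Dx /dw !dz0 ?size_letters // addr0.
  have w0 : letters R 0 = [::] by apply: size0nil; rewrite size_letters.
  by rewrite /arit !sum_cuts !big1 ?subr0 // => i _; apply: big1 => j _; rewrite /blk w0 /= ?andbF.
rewrite arit_conc // /Dx /dw -addrA; congr (_ + _).
rewrite dz_conc // n0 ev_letters /Lb mulrBr addrC; congr (_ + _).
rewrite /Kb mulr_sumr; apply: eq_bigr => d _.
by rewrite mulr_sumr; apply: eq_bigr => r _.
Qed.
End Existence.

Section Uniqueness.
Variable R : comAlgType rat.
Local Notation bimould := (bimould R).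
Local Notation word := (word R).

Definition emon (d : nat) (x : seq (nat * nat)) : 'X_{1..d + d} :=
  [multinom match split k with
            | inl i => (nth (0, 0) x i).2
            | inr i => (nth (0, 0) x i).1
            end | k < d + d]%N.
Definition monob (x : seq (nat * nat)) : bimould :=
  fun n => if n == size x then 'X_[emon n x] else 0.

Lemma monob_bari x : x != [::] -> bari (monob x).
Proof.
rewrite -size_eq0 => h; split; first by rewrite /monob eq_sym (negbTE h).
by exists (size x).+1 => d hd; rewrite /monob gtn_eqF.
Qed.

Lemma ev_monob x n (w : word n) :
  ev (monob x) w = if size w == size x then
     \prod_(i < size x) (usub w i ^+ (nth (0,0) x i).2 * vsub w i ^+ (nth (0,0) x i).1) else 0%N%:R.
Proof.
rewrite /ev /monob; case: eqP => [e|_]; last by rewrite mmap0.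
rewrite mmapX /mmap1 big_split_ord /= -big_split /= e.
apply: eq_bigr => i _; rewrite !mnmE.
rewrite -/(unsplit (inl i)) -/(unsplit (inr i)) !unsplitK /=.
by case: _ / e i => i.
Qed.

Lemma monob_cons y x : monob (y :: x) = mu (monob [:: y]) (monob x).
Proof.
apply: functional_extensionality_dep => n.
rewrite -(ev_letters (monob _) n) -(ev_letters (mu _ _) n) ev_mu.
set w := letters R n; case: (boolP (n == (size x).+1)) => [/eqP e|ne]; last first.
  have sw : size w = n by exact: size_letters.
  rewrite ev_monob sw (negbTE ne) big_nat_cond big1 // => j /andP [/andP [_ jn] _].
  rewrite !ev_monob size_drop size_takel sw //=; case: eqP => j1; last by rewrite mul0r.
  by case: eqP => j2; rewrite ?mulr0 //; lia.
have sw : size w = (size x).+1 by rewrite size_letters.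
rewrite (bigD1_seq 1%N) ?iota_uniq ?mem_index_iota //=; last lia.
rewrite [X in _ + X]big1_seq ?addr0; last first.
  move=> j /andP [j1]; rewrite mem_index_iota => jn.
  rewrite ev_monob size_takel ?ifN ?mul0r //; lia.
rewrite !ev_monob size_drop size_takel sw ?subn1 //= !eqxx.
rewrite big_ord_recl big_ord1; apply: (congr2 *%R).
  by rewrite /usub /vsub !nth_take.
by apply: eq_bigr => i _; rewrite /usub /vsub !nth_drop.
Qed.

Lemma bari_lin (a : R) A A' : bari A -> bari A' -> bari (bm_add (bm_scale a A) A').
Proof.
move=> [A0 [N hN]] [A0' [N' hN']]; split; first by rewrite /bm_add /bm_scale A0 A0' scaler0 addr0.
exists (N + N')%N => d hd; rewrite /bm_add /bm_scale hN ?hN' ?scaler0 ?addr0 //; lia.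
Qed.

Lemma urit_ext (B : bimould) D D' : is_urit B D -> is_urit B D' ->
  forall A, bari A -> D A = D' A.
Proof.
move=> h h'.
pose E (A : bimould) := bari A /\ D A = D' A.
have Elin a A A' : E A -> E A' -> E (bm_add (bm_scale a A) A').
  move=> [bA e] [bA' e']; split; first exact: bari_lin.
  by rewrite (urit_linear h) // (urit_linear h') // e e'.
have Emon x : x != [::] -> E (monob x).
  elim: x => // y x IH _; split; first exact: monob_bari.
  case: (eqVneq x [::]) => [->|xn].
    have c : concentrated1 (monob [:: y]) by move=> d hd; rewrite /monob (negbTE hd).
    by apply: functional_extensionality_dep => n; rewrite (urit_depth1 h) // (urit_depth1 h').
  have b1 : bari (monob [:: y]) by exact: monob_bari.
  have e1 : D (monob [:: y]) = D' (monob [:: y]).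
    have c : concentrated1 (monob [:: y]) by move=> d hd; rewrite /monob (negbTE hd).
    by apply: functional_extensionality_dep => n; rewrite (urit_depth1 h) // (urit_depth1 h').
  have [b2 e2] := IH xn.
  rewrite monob_cons (urit_mu h b1 b2) (urit_mu h' b1 b2) e1.
  by apply: (congr1 (fun X => bm_add _ (mu _ X))).
have b0 : bari (fun _ => 0) by split=> //; exists 0%N.
have E0 : E (fun _ => 0).
  have e : (fun _ => 0) = bm_add (bm_scale (-1) (fun _ => 0)) (fun _ => 0) :> bimould.
    by apply: functional_extensionality_dep => n; rewrite /bm_add /bm_scale scaler0 addr0.
  split=> //; apply: functional_extensionality_dep => n.
  by rewrite !(urit_depth1 h, urit_depth1 h') // => d _.
have Esum (T : Type) (r : seq T) (c : T -> R) (F : T -> bimould) :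
   (forall t, E (F t)) -> E (fun n => \sum_(t <- r) c t *: F t n).
  move=> hF; elim: r => [|t r IH].
    by have -> : (fun n => \sum_(t <- [::]) c t *: F t n) = (fun _ => 0) :> bimould
      by apply: functional_extensionality_dep => n; rewrite big_nil.
  have -> : (fun n => \sum_(t <- t :: r) c t *: F t n)
    = bm_add (bm_scale (c t) (F t)) (fun n => \sum_(t <- r) c t *: F t n) :> bimould.
    by apply: functional_extensionality_dep => n; rewrite big_cons.
  exact: Elin.
move=> A [A0 [N hN]].
pose wd d (m : 'X_{1..d + d}) := [seq (m (rshift d i), m (lshift d i)) | i <- enum 'I_d].
have sw d (m : 'X_{1..d + d}) : size (wd d m) = d by rewrite size_map size_enum_ord.
have ew d (m : 'X_{1..d + d}) : emon d (wd d m) = m.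
  apply/mnmP => k; rewrite mnmE; case: (split_ordP k) => i ->.
    by rewrite (nth_map i) ?size_enum_ord // nth_ord_enum.
  by rewrite (nth_map i) ?size_enum_ord // nth_ord_enum.
pose Ad d : bimould := fun n => \sum_(m <- msupp (A d)) (A d)@_m *: monob (wd d m) n.
have EAd d : (0 < d)%N -> E (Ad d).
  by move=> d0; apply: Esum => m; apply: Emon; rewrite -size_eq0 sw -lt0n.
have AdE d : Ad d d = A d.
  rewrite [RHS]mpolyE /Ad; apply: eq_bigr => m _.
  by rewrite /monob sw eqxx ew.
have Ad0 d n : n != d -> Ad d n = 0.
  by move=> nd; rewrite /Ad big1 // => m _; rewrite /monob sw (negbTE nd) scaler0.
suff HE : E A by exact: (proj2 HE).
have eA : A = fun n => \sum_(d <- iota 1 N) 1 *: (if (0 < d)%N then Ad d else fun _ => 0) n.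
  apply: functional_extensionality_dep => n.
  case: (boolP (n \in iota 1 N)) => nN.
    rewrite (bigD1_seq n) ?iota_uniq //= big1 ?addr0 ?scale1r.
      by move: nN; rewrite mem_iota => /andP [-> _]; rewrite AdE.
    by move=> d dn; case: ifP => _; rewrite ?scaler0 // Ad0 ?scaler0 // eq_sym.
  rewrite big1_seq; last first.
    move=> d /andP [_ dN]; case: ifP => _; rewrite ?scaler0 // Ad0 ?scaler0 //.
    by apply: contraNneq nN => ->.
  case: n nN => // n; rewrite mem_iota => h1; apply: hN; lia.
rewrite eA; apply: (Esum _ _ (fun _ => 1) (fun d => if (0 < d)%N then Ad d else fun _ => 0)) => d.
by case: ifP => [d0|_]; [exact: EAd|exact: E0].
Qed.

Lemma uritP (B : bimould) : bari B -> is_urit B (urit B).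
Proof.
by move=> hB; apply: epsilon_spec; exists (@Dx R B); exact: is_urit_Dx.
Qed.
End Uniqueness.

(* Main.v *)
(* Let w = (w_1, w_2, w_3), and write f = B_1. Under the swap substitution the terms of
   preuri(A, B)(w) which contain A_2 B_1 are permuted, by swap invariance and by f(-w) = f(w).
   Those which contain A_1 B_2 are permuted up to A_1(u_1 + u_2 + u_3, v_1) times the difference of
   B_2(u_2, u_3; v_2 - v_1, v_3 - v_1) and its push. Alternating swap and the depth 2
   stuffle relation
     B_2(w_1, w_2) + B_2(w_2, w_1) + (f(u_1 + u_2, v_1) - f(u_1 + u_2, v_2)) / (v_1 - v_2) = 0
   four times turns B_2 into its push, and the four divided differences of f
   collected on the way are exactly those of the depth 3 part of urit(B) and of its swap. *)
Require Import Defs.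
From HB Require Import structures.
From mathcomp Require Import all_boot all_order all_algebra.
From mathcomp Require Import mpoly.
From mathcomp Require Import ring zify.
From Stdlib Require Import ClassicalEpsilon.

Set Implicit Arguments.
Unset Strict Implicit.
Unset Printing Implicit Defensive.

Import GRing.Theory Num.Theory.
Local Open Scope ring_scope.

(** * The depth 2 stuffle relation, from coefficients to polynomials *)

Section Evaluation.
Variable R : comAlgType rat.
Implicit Types M A B : bimould R.

Lemma ev1E M n (u x : {mpoly R[n]}) :
  ev M [:: (u, x)] =
    \sum_(m <- msupp (M 1%N)) (M 1%N)@_m *: (u ^+ m ord0 * x ^+ m ord_max).
Proof.
rewrite /ev /mmap; apply: eq_bigr => m _; rewrite mul_mpolyC; congr (_ *: _).
rewrite /mmap1 big_split_ord !big_ord1 /=.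
rewrite -/(unsplit (inl ord0)) -/(unsplit (inr ord0)) !unsplitK /=.
by congr (_ ^+ m _ * _ ^+ m _); apply: val_inj.
Qed.

(** The exponent of u_1^a u_2^b v_1^i v_2^j: in depth 2 both [u]-variables precede both
    [v]-variables. *)
Definition multinom4 (a b i j : nat) : 'X_{1..2 + 2} :=
  [multinom nth 0 [:: a; b; i; j] k | k < 2 + 2]%N.

Lemma multinom4E (m : 'X_{1..2 + 2}) : exists a b i j, m = multinom4 a b i j.
Proof.
exists (m (@Ordinal 4 0 isT)), (m (@Ordinal 4 1 isT)).
exists (m (@Ordinal 4 2 isT)), (m (@Ordinal 4 3 isT)).
apply/mnmP => -[[|[|[|[|//]]]] lt_k]; rewrite mnmE /=; congr (m _); exact: val_inj.
Qed.

Lemma eq_multinom4 a b i j a' b' i' j' :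
  (multinom4 a b i j == multinom4 a' b' i' j') =
  [&& a == a', b == b', i == i' & j == j'].
Proof.
apply/eqP/idP => [/mnmP e|/and4P[/eqP-> /eqP-> /eqP-> /eqP->] //].
have := (e (@Ordinal 4 0 isT), e (@Ordinal 4 1 isT),
         e (@Ordinal 4 2 isT), e (@Ordinal 4 3 isT)).
by rewrite !mnmE /= => -[[[-> ->] ->] ->]; rewrite !eqxx.
Qed.

Lemma mpolyX4 (a b i j : nat) : 'X_[multinom4 a b i j] =
  'X_(@Ordinal 4 0 isT) ^+ a * 'X_(@Ordinal 4 1 isT) ^+ b *
  'X_(@Ordinal 4 2 isT) ^+ i * 'X_(@Ordinal 4 3 isT) ^+ j :> {mpoly R[2 + 2]}.
Proof.
rewrite mpolyXE_id !big_ord_recl big_ord0 /= !mnmE /= mulr1 !mulrA.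
by congr ('X_ _ ^+ _ * 'X_ _ ^+ _ * 'X_ _ ^+ _ * 'X_ _ ^+ _); apply: val_inj.
Qed.

Lemma letters2E : letters R 2 =
  [:: ('X_(@Ordinal 4 0 isT), 'X_(@Ordinal 4 2 isT));
      ('X_(@Ordinal 4 1 isT), 'X_(@Ordinal 4 3 isT))].
Proof.
rewrite /letters !enum_ordSl enum_ord0 /=.
by do 4?[congr (_ :: _) | congr (_, _)]; congr 'X_ _; apply: val_inj.
Qed.

Lemma ev2E M n (u1 u2 x y : {mpoly R[n]}) :
  ev M [:: (u1, x); (u2, y)] =
    \sum_(m <- msupp (M 2%N)) (M 2%N)@_m *:
      (u1 ^+ m (@Ordinal 4 0 isT) * u2 ^+ m (@Ordinal 4 1 isT) *
       x ^+ m (@Ordinal 4 2 isT) * y ^+ m (@Ordinal 4 3 isT)).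
Proof.
rewrite /ev /mmap; apply: eq_bigr => m _; rewrite mul_mpolyC; congr (_ *: _).
rewrite /mmap1 big_split_ord !big_ord_recl !big_ord0 /= !mulr1.
rewrite -/(unsplit (inl (ord0 : 'I_2))) -/(unsplit (inr (ord0 : 'I_2))).
rewrite -/(unsplit (inl (lift ord0 ord0 : 'I_2))) -/(unsplit (inr (lift ord0 ord0 : 'I_2))).
rewrite !unsplitK /= !mulrA.
by congr (_ ^+ m _ * _ ^+ m _ * _ ^+ m _ * _ ^+ m _); apply: val_inj.
Qed.

Lemma mcoeff_linear n k (p : {mpoly R[n]}) (F : 'X_{1..n} -> {mpoly R[k]}) l m c :
  (forall m', (F m')@_l = (m' == m)%:R * c) ->
  (\sum_(m' <- msupp p) p@_m' *: F m')@_l = p@_m * c.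
Proof.
move=> eF; rewrite raddf_sum /=.
transitivity (\sum_(m' <- msupp p) if m' == m then p@_m * c else 0).
  apply: eq_bigr => m' _; rewrite mcoeffZ eF; case: eqP => [->|_]; first by rewrite mul1r.
  by rewrite mul0r mulr0.
rewrite -big_mkcond; case: (boolP (m \in msupp p)) => m_p.
  by rewrite -big_filter filter_pred1_uniq ?msupp_uniq // big_seq1.
by rewrite (memN_msupp_eq0 m_p) mul0r big1_seq.
Qed.

Definition multinom2 (a i : nat) : 'X_{1..1 + 1} :=
  [multinom nth 0 [:: a; i] k | k < 1 + 1]%N.

Lemma eq_multinom2 (m : 'X_{1..1 + 1}) a i :
  (m == multinom2 a i) = (m ord0 == a) && (m ord_max == i).
Proof.
apply/eqP/andP => [-> |[/eqP ea /eqP ei]]; first by rewrite !mnmE !eqxx.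
apply/mnmP => -[[|[|//]] lt_k]; rewrite mnmE /= -?ea -?ei; congr (m _); exact: val_inj.
Qed.

(** This is phi(x * y) = 0 for the one-letter words y_{i+1,a} and y_{j+1,b}, divided by a! b!. The
    merged letter is y_{i+j+2,a+b}: its [v]-exponent is i + j + 1, and its own normalisation
    1/(a+b)! leaves the binomial coefficient. *)
Lemma alternil_mcoeff M a b i j : alternil M ->
  (M 2)@_(multinom4 a b i j) + (M 2)@_(multinom4 b a j i)
    + (M 1)@_(multinom2 (a + b) (i + j).+1) * 'C(a + b, a)%:R = 0.
Proof.
case=> phi [phiE phi_stuffle].
have M2E a' b' i' j' : (M 2)@_(multinom4 a' b' i' j') =
    (a'`!%:R * b'`!%:R)^-1 *: phi [:: (i'.+1, a'); (j'.+1, b')].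
  have := phiE [:: (i'.+1, a'); (j'.+1, b')] isT.
  rewrite !big_cons big_nil mulr1 /= => <-; congr (_@__).
  by apply/mnmP => -[[|[|[|[|//]]]] lt_k]; rewrite !mnmE /=;
    case: split_ordP => -[[|[|//]] lt_l] //= /(congr1 val).
have M1E : (M 1)@_(multinom2 (a + b) (i + j).+1) =
    ((a + b)`!%:R)^-1 *: phi [:: ((i.+1 + j.+1)%N, (a + b)%N)].
  have := phiE [:: ((i.+1 + j.+1)%N, (a + b)%N)] isT.
  rewrite !big_cons big_nil mulr1 /= => <-; congr (_@__).
  by apply/mnmP => -[[|[|//]] lt_k]; rewrite !mnmE /=;
    case: split_ordP => -[[|//] lt_l] //= /(congr1 val) //= _; rewrite addnS.
have binE : ((a + b)`!%:R)^-1 * 'C(a + b, a)%:R = (a`!%:R * b`!%:R)^-1 :> rat.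
  have /(congr1 (fun n => n%:R : rat)) := bin_fact (leq_addr b a).
  rewrite addKn !natrM => <-; rewrite !invfM mulrAC mulVf ?mul1r //.
  by rewrite pnatr_eq0 -lt0n bin_gt0 leq_addr.
rewrite !M2E M1E -scalerAl [phi _ * _]mulr_natr -scalerMnr scalerMnl.
rewrite -[_^-1 *+ _]mulr_natr binE [b`!%:R * _]mulrC -!scalerDr.
have := phi_stuffle [:: (i.+1, a)] [:: (j.+1, b)] isT isT isT isT.
by rewrite /= !big_cons big_nil addr0 addrA => ->; rewrite scaler0.
Qed.

(* The coefficientwise form of the third term of the stuffle relation is the
   divided difference of [p (u1 + u2, -)] at the two [v]-variables. *)
Lemma divided_difference (p : {mpoly R[1 + 1]}) :
  let u1 := 'X_(@Ordinal 4 0 isT) in let u2 := 'X_(@Ordinal 4 1 isT) in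
  let v1 := 'X_(@Ordinal 4 2 isT) in let v2 := 'X_(@Ordinal 4 3 isT) in
  let p_at u v := \sum_(m <- msupp p) p@_m *: (u ^+ m ord0 * v ^+ m ord_max) in
  exists D : {mpoly R[2 + 2]},
    (v1 - v2) * D = p_at (u1 + u2) v1 - p_at (u1 + u2) v2 /\
    forall a b i j, D@_(multinom4 a b i j) =
      p@_(multinom2 (a + b) (i + j).+1) * 'C(a + b, a)%:R.
Proof.
move=> u1 u2 v1 v2 p_at.
(* Monomial by monomial, (v1^n - v2^n) / (v1 - v2) is the sum of v1^(n-1-l) v2^l over l < n, which
   is empty for n = 0. *)
pose D := \sum_(m <- msupp p) p@_m *: ((u1 + u2) ^+ m ord0 *
  \sum_(l < m ord_max) v1 ^+ ((m ord_max).-1 - l) * v2 ^+ l).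
exists D; split.
  rewrite mulr_sumr -sumrB; apply: eq_bigr => m _.
  rewrite -scalerAr -scalerBr -mulrBr subrXX; congr (_ *: _).
  rewrite mulrCA; congr (_ * (_ * _)); apply: eq_bigr => l _; congr (_ ^+ _ * _); lia.
move=> a b i j; apply: mcoeff_linear => m.
rewrite exprDn mulr_suml raddf_sum /=.
(* Here [s] is the exponent of [u2] in the binomial expansion and [l] that of [v2], so only s = b
   and l = j contribute. *)
transitivity (\sum_(s < (m ord0).+1) \sum_(l < m ord_max)
    ([&& s == b :> nat, l == j :> nat & m == multinom2 (a + b) (i + j).+1])%:R
     * 'C(a + b, a)%:R : R).
  apply: eq_bigr => s _; rewrite mulr_sumr raddf_sum /=; apply: eq_bigr => l _.
  rewrite [in LHS]mulrnAl mcoeffMn !mulrA -mpolyX4 mcoeffX eq_multinom4 eq_multinom2.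
  have [lt_s lt_l] := (ltn_ord s, ltn_ord l).
  set c := (X in (nat_of_bool X)%:R *+ _); set c' := (X in _ = (nat_of_bool X)%:R * _).
  have <- : c = c' by rewrite /c /c'; lia.
  case: (boolP c) => [/and4P[/eqP ea /eqP eb _ _]|_]; last by rewrite !mul0rn mul0r.
  rewrite eb; have -> : m ord0 = (a + b)%N by lia.
  by rewrite mul1r -[in RHS]bin_sub ?leq_addr // addKn.
case: (eqVneq m (multinom2 (a + b) (i + j).+1)) => [em|_]; last first.
  by rewrite mul0r big1 // => s _; rewrite big1 // => l _; rewrite !andbF mul0r.
have lt_b : (b < (m ord0).+1)%N by rewrite em mnmE /= ltnS leq_addl.
have lt_j : (j < m ord_max)%N by rewrite em mnmE /= ltnS leq_addl.
rewrite (bigD1 (Ordinal lt_b)) //= [X in _ + X]big1 ?addr0; last first.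
  move=> s ne_s; rewrite big1 // => l _.
  by rewrite (negPf (ne_s : val s != b)) mul0r.
rewrite (bigD1 (Ordinal lt_j)) //= [X in _ + X]big1 ?addr0 ?eqxx // => l ne_l.
by rewrite (negPf (ne_l : val l != j)) mul0r.
Qed.

(** * Stuffle relation and divided differences at arbitrary arguments *)

Lemma sbtX n m (h : 'I_n -> {mpoly R[m]}) i : sbt h 'X_i = h i.
Proof. by rewrite /sbt mmapX mmap1U. Qed.

Lemma alternil_generic M : alternil M ->
  let u1 := 'X_(@Ordinal 4 0 isT) in let u2 := 'X_(@Ordinal 4 1 isT) in
  let v1 := 'X_(@Ordinal 4 2 isT) in let v2 := 'X_(@Ordinal 4 3 isT) in
  (v1 - v2) * (ev M [:: (u1, v1); (u2, v2)] + ev M [:: (u2, v2); (u1, v1)])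
  = ev M [:: (u1 + u2, v2)] - ev M [:: (u1 + u2, v1)].
Proof.
move=> M_il u1 u2 v1 v2.
have [D [DE D_mcoeff]] := divided_difference (M 1%N).
rewrite !ev1E -[LHS]opprK -[RHS]opprK -mulrN; congr (- _); rewrite opprB -DE.
congr (_ * _); apply/eqP; rewrite eq_sym -subr_eq0 opprK addrC; apply/eqP.
apply/mpolyP => m; have [a [b [i [j ->]]]] := multinom4E m.
rewrite -letters2E (ev_letters M 2) ev2E 2!mcoeffD mcoeff0 D_mcoeff.
(* Exchanging the two letters exchanges [a] with [b] and [i] with [j] in the exponents. *)
rewrite (@mcoeff_linear _ _ _ _ _ (multinom4 b a j i) 1) ?mulr1.
  exact: alternil_mcoeff.
move=> m'; have [a' [b' [i' [j' ->]]]] := multinom4E m'.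
rewrite !mnmE /= mulr1 [X in X * _ * _]mulrC -mulrA [X in _ * X]mulrC mulrA.
by rewrite -mpolyX4 mcoeffX !eq_multinom4; congr _%:R; lia.
Qed.

Lemma alternil_ev M : alternil M -> forall n (u1 u2 v1 v2 : {mpoly R[n]}),
  (v1 - v2) * (ev M [:: (u1, v1); (u2, v2)] + ev M [:: (u2, v2); (u1, v1)])
  = ev M [:: (u1 + u2, v2)] - ev M [:: (u1 + u2, v1)].
Proof.
move=> M_il n u1 u2 v1 v2.
pose h (k : 'I_4) := nth 0 [:: u1; u2; v1; v2] k.
have /(congr1 (sbt h)) := alternil_generic M_il.
by rewrite rmorphM rmorphB rmorphD rmorphB /= -!ev_map /= !rmorphD /= !sbtX.
Qed.

(* At generic arguments v1 - v2 is not a zero divisor. *)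
Lemma eq_generic4
    (F G : forall n, {mpoly R[n]} -> {mpoly R[n]} -> {mpoly R[n]} -> {mpoly R[n]} -> {mpoly R[n]}) :
  let natural F := forall n m (h : 'I_n -> {mpoly R[m]}) u1 u2 v1 v2,
    F m (sbt h u1) (sbt h u2) (sbt h v1) (sbt h v2) = sbt h (F n u1 u2 v1 v2) in
  natural F -> natural G ->
  (forall n u1 u2 v1 v2, (v1 - v2) * F n u1 u2 v1 v2 = (v1 - v2) * G n u1 u2 v1 v2) ->
  forall n u1 u2 v1 v2, F n u1 u2 v1 v2 = G n u1 u2 v1 v2.
Proof.
move=> natural F_nat G_nat eFG n u1 u2 v1 v2.
pose h (k : 'I_4) := nth 0 [:: u1; u2; v1; v2] k.
have [-> -> -> ->] : [/\ u1 = sbt h 'X_(@Ordinal 4 0 isT), u2 = sbt h 'X_(@Ordinal 4 1 isT),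
  v1 = sbt h 'X_(@Ordinal 4 2 isT) & v2 = sbt h 'X_(@Ordinal 4 3 isT)].
  by rewrite !sbtX.
rewrite F_nat G_nat; congr (sbt h _).
exact: (@lregXB R 4 (@Ordinal 4 2 isT) (@Ordinal 4 3 isT) isT _ _ (eFG _ _ _ _ _)).
Qed.

(* For alternil M this is (M_1(u, x) - M_1(u, y)) / (x - y); defined without a quotient,
   it commutes with every substitution. *)
Definition ddiff M n (u x y : {mpoly R[n]}) :=
  - (ev M [:: (u, x); (0, y)] + ev M [:: (0, y); (u, x)]).

Lemma ddiffP M n (u x y : {mpoly R[n]}) : alternil M ->
  (x - y) * ddiff M u x y = ev M [:: (u, x)] - ev M [:: (u, y)].
Proof. by move=> M_il; rewrite /ddiff mulrN alternil_ev // addr0 opprB. Qed.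

Lemma ddiff_sbt M n m (h : 'I_n -> {mpoly R[m]}) u x y :
  ddiff M (sbt h u) (sbt h x) (sbt h y) = sbt h (ddiff M u x y).
Proof.
by rewrite /ddiff rmorphN rmorphD /= -!ev_map /= !rmorph0.
Qed.

(** Both sides commute with substitutions and agree after multiplication by v1 - v2, so the factor
    can be cancelled at generic arguments, even if v1 - v2 is zero at the given ones. *)
Lemma alternil_stuffle M : alternil M -> forall n (u1 u2 v1 v2 : {mpoly R[n]}),
  ev M [:: (u1, v1); (u2, v2)] + ev M [:: (u2, v2); (u1, v1)] = - ddiff M (u1 + u2) v1 v2.
Proof.
move=> M_il.
apply: (@eq_generic4
  (fun n u1 u2 v1 v2 => ev M [:: (u1, v1); (u2, v2)] + ev M [:: (u2, v2); (u1, v1)])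
  (fun n u1 u2 v1 v2 => - ddiff M (u1 + u2) v1 v2)) => [n m h *|n m h *|n *].
- by rewrite rmorphD /= -!ev_map.
- by rewrite rmorphN /= -ddiff_sbt rmorphD.
by rewrite alternil_ev // mulrN ddiffP // opprB.
Qed.

(** The left side of the stuffle relation does not change when its two letters are exchanged. *)
Lemma ddiff_sym M n (u x y : {mpoly R[n]}) : alternil M ->
  ddiff M u x y = ddiff M u y x.
Proof.
move=> M_il; have e := alternil_stuffle M_il u 0 x y.
have e' := alternil_stuffle M_il 0 u y x.
rewrite (addr0 u) in e; rewrite (add0r u) in e'.
by apply: oppr_inj; exact: etrans (esym e) (etrans (addrC _ _) e').
Qed.

Lemma even1_ev M : even1 M -> forall n (u v : {mpoly R[n]}),
  ev M [:: (- u, - v)] = ev M [:: (u, v)].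
Proof.
move=> M_even n u v; pose w := [:: (u, v)].
rewrite -/w -(map_letters (erefl (size w))) ev_map ev_letters -M_even -ev_map.
rewrite /mapw -map_comp; congr ev.
have := map_letters (erefl (size w)); rewrite {2}/w.
case: (letters R 1) => [|x [|y s]] //= [eu ev].
by rewrite !rmorphN /= eu ev.
Qed.

(** The numerator of the divided difference is even and its denominator is odd. *)
Lemma ddiffN M n (u x y : {mpoly R[n]}) : alternil M -> even1 M ->
  ddiff M (- u) (- x) (- y) = - ddiff M u x y.
Proof.
move=> M_il M_even.
apply: (@eq_generic4 (fun n u _ x y => ddiff M (- u) (- x) (- y))
  (fun n u _ x y => - ddiff M u x y) _ _ _ n u 0) => [? ? h *|? ? h *|k u1 _ v1 v2].
- by rewrite -ddiff_sbt !rmorphN.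
- by rewrite rmorphN /= -ddiff_sbt.
have := ddiffP (- u1) (- v1) (- v2) M_il.
rewrite (even1_ev M_even u1 v1) (even1_ev M_even u1 v2) -(ddiffP u1 v1 v2 M_il).
move: (ddiff M (- u1) (- v1) (- v2)) (ddiff M u1 v1 v2) => d d' e.
by rewrite mulrN -e; ring.
Qed.

(** * The fractions in [urit] with two nodes *)

(** The common denominator is a product of differences of distinct variables, hence regular, and the
    quotient chosen by [epsilon] is the only one. *)
Lemma sumfrac_unique n (I : seq nat) N (Q : {mpoly R[n + n]}) :
  all (fun i => i < n)%N I -> is_sumfrac I (vsub (letters R n)) N Q ->
  sumfrac I (vsub (letters R n)) N = Q.
Proof.
move=> lt_I QP; have QP' := epsilon_spec (inhabits 0) _ (ex_intro _ Q QP).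
apply: (lreg_prods (R := R) lt_I); rewrite /= mulrC QP' -QP; exact: mulrC.
Qed.

Lemma sumfrac2 n i j N (Q : {mpoly R[n + n]}) : (i < n)%N -> (j < n)%N -> i != j ->
  let v := vsub (letters R n) in (v j - v i) * Q = N i - N j ->
  sumfrac [:: i; j] v N = Q.
Proof.
move=> lt_i lt_j ne_ij v QE; apply: sumfrac_unique; first by rewrite /= lt_i lt_j.
have ne_ji : (j == i) = false by rewrite eq_sym (negPf ne_ij).
rewrite /is_sumfrac !(big_cons, big_nil) !eqxx ne_ji (negPf ne_ij) /= !mulr1 -/v.
by rewrite mulrA [Q * _]mulrC QE; ring.
Qed.

(** * Explicit components of [preuri] in depths 1, 2 and 3 *)

Lemma mapw_shiftv n m (h : 'I_n -> {mpoly R[m]}) x (w : word R n) :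
  mapw (sbt h) (shiftv x w) = shiftv (sbt h x) (mapw (sbt h) w).
Proof.
by rewrite /mapw /shiftv -!map_comp; apply: eq_map => y /=; rewrite rmorphB.
Qed.

Lemma mapw_swapw n m (h : 'I_n -> {mpoly R[m]}) (w : word R n) :
  mapw (sbt h) (swapw w) = swapw (mapw (sbt h) w).
Proof.
rewrite /swapw /mapw size_map -map_comp; apply: eq_map => i /=.
by rewrite rmorphB /= -!vsub_map -usum_map /mapw map_take.
Qed.

Lemma ev_swap M n (w : word R n) : ev (swap M) w = ev M (swapw w).
Proof.
apply: (@ev_nat _ _ (fun n w => ev M (swapw w))) => // n' m h w'.
by rewrite -mapw_swapw ev_map.
Qed.

Lemma ev_Pb B n (w : word R n) :
  ev (Pb B) w = ev B (shiftv (vsub w (size w).-1) (take (size w).-1 w)).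
Proof.
apply: (@ev_nat _ _ (fun n w => ev B (shiftv (vsub w (size w).-1) (take (size w).-1 w)))).
  by move=> d; rewrite /Pb size_letters.
by move=> n' m h w'; rewrite -ev_map mapw_shiftv size_map vsub_map /mapw map_take.
Qed.

Lemma ev_Lb B n (w : word R n) :
  ev (Lb B) w = ev (Kb B) w - ev B (shiftv (vsub w 0) (behead w)).
Proof.
apply: (@ev_nat _ _ (fun n w => ev (Kb B) w - ev B (shiftv (vsub w 0) (behead w)))).
  by move=> d; rewrite /Lb ev_letters.
by move=> n' m h w'; rewrite rmorphB /= -!ev_map mapw_shiftv vsub_map /mapw behead_map.
Qed.

Lemma ev_Kb_small B n (w : word R n) : (size w <= 2)%N -> ev (Kb B) w = 0.
Proof.
move=> le_w2; apply: (ev0 (erefl (size w))).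
rewrite /Kb big_nat_cond big1 // => d /andP[/andP[d_gt0 _] _].
rewrite big_nat_cond big1 // => r /andP[/andP[r_gt0 _] /eqP]; lia.
Qed.

(** Only d = r = 1 satisfies d + r + 1 = 3. The two index sets are then {1, 3} and {1, 2}, and each
    sum of fractions has two nodes, so it is a divided difference of B_1. *)
Lemma ev_Kb3 B n (u1 u2 u3 v1 v2 v3 : {mpoly R[n]}) : alternil B ->
  ev (Kb B) [:: (u1, v1); (u2, v2); (u3, v3)] =
    ddiff B u2 (v2 - v1) (v2 - v3) - ddiff B u3 (v3 - v1) (v3 - v2).
Proof.
move=> B_il.
pose G n (w : word R n) :=
  ddiff B (usub w 1) (vsub w 1 - vsub w 0) (vsub w 1 - vsub w 2)
  - ddiff B (usub w 2) (vsub w 2 - vsub w 0) (vsub w 2 - vsub w 1).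
have Kb3 : Kb B 3 = G _ (letters R 3).
  rewrite /Kb unlock /= !addr0 /urit_br /=.
  set w := letters R 3.
  have [-> ->] : take 1 (drop 1 w) = [:: (usub w 1, vsub w 1)]
      /\ take 1 (drop 2 w) = [:: (usub w 2, vsub w 2)].
    rewrite /usub /vsub; have: size w = 3 by exact: size_letters.
    by case: (w) => [|[? ?] [|[? ?] [|[? ?] []]]].
  rewrite /G -/w.
  by congr (_ - _); apply: sumfrac2 => //; rewrite -/w -ddiffP //; congr (_ * _); ring.
pose w := [:: (u1, v1); (u2, v2); (u3, v3)].
transitivity (sbt (@hw R n w 3) (Kb B 3)); first exact: evE.
rewrite Kb3 rmorphB /= -2!ddiff_sbt 4!rmorphB /=.
by rewrite -!usub_map -!vsub_map (map_letters (erefl (size w))).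
Qed.

(** Uniqueness on BARI replaces the abstractly chosen derivation by the explicit one, which
    contracts a factor of the word to a single letter and can be expanded in each depth. *)
Lemma urit_Dx A B : bari A -> bari B -> urit B A = Dx B A.
Proof.
by move=> A_bari B_bari; apply: urit_ext A_bari; [apply: uritP | apply: is_urit_Dx].
Qed.

Lemma ev_preuri A B n (w : word R n) : bari A -> bari B ->
  ev (preuri A B) w = dw B A w + ev (mu A B) w.
Proof.
move=> A_bari B_bari; rewrite -ev_Dx -urit_Dx // /ev /preuri /bm_add.
exact: mmapD.
Qed.

Lemma ev_nil M n : bari M -> ev M ([::] : word R n) = 0.
Proof. by case=> M0 _; apply: (ev0 (erefl _)). Qed.

Lemma ev_preuri1 A B n (u v : {mpoly R[n]}) : bari A -> bari B ->
  ev (preuri A B) [:: (u, v)] = 0.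
Proof.
move=> A_bari B_bari; rewrite ev_preuri // ev_mu /dw /dz unlock /=.
rewrite !ev_Pb !ev_Lb /= !ev_Kb_small // !ev_nil //.
by move: (@ev R A n) (@ev R B n) => a b; ring.
Qed.

Lemma ev_preuri2 A B n (u1 u2 v1 v2 : {mpoly R[n]}) : bari A -> bari B ->
  ev (preuri A B) [:: (u1, v1); (u2, v2)] =
    ev A [:: (u1 + u2, v2)] * ev B [:: (u1, v1 - v2)]
    - ev A [:: (u1 + u2, v1)] * ev B [:: (u2, v2 - v1)]
    + ev A [:: (u1, v1)] * ev B [:: (u2, v2)].
Proof.
move=> A_bari B_bari; rewrite ev_preuri // ev_mu /dw /dz unlock /= /blk /=.
rewrite !ev_Pb !ev_Lb /= !ev_Kb_small // !ev_nil //.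
(* With [ev] abstract, comparisons of terms do not unfold it. *)
move: (@ev R A n) (@ev R B n) => a b.
by rewrite /z1 /z2 /vsub /usum !(big_cons, big_nil) /= !addr0; ring.
Qed.

(** Contracting a factor of two letters gives the first four products, [mu] the next two, and
    contracting the whole word the others; the last one is the part of [urit] with d = r = 1. *)
Lemma ev_preuri3 A B n (u1 u2 u3 v1 v2 v3 : {mpoly R[n]}) :
  bari A -> bari B -> alternil B ->
  ev (preuri A B) [:: (u1, v1); (u2, v2); (u3, v3)] =
    ev A [:: (u1 + u2, v2); (u3, v3)] * ev B [:: (u1, v1 - v2)]
    - ev A [:: (u1 + u2, v1); (u3, v3)] * ev B [:: (u2, v2 - v1)]
    + ev A [:: (u1, v1); (u2 + u3, v3)] * ev B [:: (u2, v2 - v3)]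
    - ev A [:: (u1, v1); (u2 + u3, v2)] * ev B [:: (u3, v3 - v2)]
    + ev A [:: (u1, v1); (u2, v2)] * ev B [:: (u3, v3)]
    + ev A [:: (u1, v1)] * ev B [:: (u2, v2); (u3, v3)]
    + ev A [:: (u1 + (u2 + u3), v3)] * ev B [:: (u1, v1 - v3); (u2, v2 - v3)]
    - ev A [:: (u1 + (u2 + u3), v1)] * ev B [:: (u2, v2 - v1); (u3, v3 - v1)]
    + ev A [:: (u1 + (u2 + u3), v1)] *
      (ddiff B u2 (v2 - v1) (v2 - v3) - ddiff B u3 (v3 - v1) (v3 - v2)).
Proof.
move=> A_bari B_bari B_il; rewrite ev_preuri // ev_mu /dw /dz unlock /= /blk /=.
rewrite !ev_Pb !ev_Lb /= ev_Kb3 // !ev_Kb_small // !ev_nil //.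
move: (@ev R A n) (@ev R B n) (@ddiff B n) => a b d.
by rewrite /z1 /z2 /vsub /usum !(big_cons, big_nil) /= !addr0; ring.
Qed.

Lemma swapw1 n (u v : {mpoly R[n]}) : swapw [:: (u, v)] = [:: (v, u)].
Proof. by rewrite /swapw /vsub /usum /= !(big_cons, big_nil) /= subr0 addr0. Qed.

Lemma swapw2 n (u1 u2 v1 v2 : {mpoly R[n]}) :
  swapw [:: (u1, v1); (u2, v2)] = [:: (v2, u1 + u2); (v1 - v2, u1)].
Proof. by rewrite /swapw /vsub /usum /= !(big_cons, big_nil) /= subr0 !addr0. Qed.

Lemma swapw3 n (u1 u2 u3 v1 v2 v3 : {mpoly R[n]}) :
  swapw [:: (u1, v1); (u2, v2); (u3, v3)] =
  [:: (v3, u1 + (u2 + u3)); (v2 - v3, u1 + u2); (v1 - v2, u1)].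
Proof. by rewrite /swapw /vsub /usum /= !(big_cons, big_nil) /= subr0 !addr0. Qed.

End Evaluation.

(** * Swap invariance in depths 2 and 3, as identities between functions on a commutative ring *)

Section SwapInvariance.
Variables (S : comNzRingType) (a1 b1 : S -> S -> S) (a2 b2 : S -> S -> S -> S -> S).
Hypothesis a1_swap : forall u v, a1 v u = a1 u v.
Hypothesis b1_swap : forall u v, b1 v u = b1 u v.
Hypothesis b1_even : forall u v, b1 (- u) (- v) = b1 u v.
Hypothesis a2_swap : forall u1 u2 v1 v2, a2 v2 (v1 - v2) (u1 + u2) u1 = a2 u1 u2 v1 v2.
Hypothesis b2_swap : forall u1 u2 v1 v2, b2 v2 (v1 - v2) (u1 + u2) u1 = b2 u1 u2 v1 v2.
Variable d : S -> S -> S -> S.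
Hypothesis d_sym : forall u x y, d u y x = d u x y.
Hypothesis dN : forall u x y, d (- u) (- x) (- y) = - d u x y.
Hypothesis b2_stuffle : forall u1 u2 v1 v2, b2 u1 u2 v1 v2 + b2 u2 u1 v2 v1 = - d (u1 + u2) v1 v2.

Definition depth2 (u1 u2 v1 v2 : S) :=
  a1 (u1 + u2) v2 * b1 u1 (v1 - v2) - a1 (u1 + u2) v1 * b1 u2 (v2 - v1) + a1 u1 v1 * b1 u2 v2.

(** The swap exchanges the first and the third product and fixes the second, where [b1_even] absorbs
    a sign in both arguments of [b1]. *)
Lemma depth2_swap (u1 u2 v1 v2 : S) : depth2 v2 (v1 - v2) (u1 + u2) u1 = depth2 u1 u2 v1 v2.
Proof.
rewrite /depth2.
have -> : v2 + (v1 - v2) = v1 by ring.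
have -> : u1 + u2 - u1 = u2 by ring.
have -> : u1 - (u1 + u2) = - u2 by ring.
rewrite -(b1_even u2 (v2 - v1)) opprB.
rewrite (a1_swap u1) (a1_swap (u1 + u2) v1) (a1_swap (u1 + u2) v2).
rewrite (b1_swap u2 v2) (b1_swap (- u2)) (b1_swap u1); ring.
Qed.

Definition depth3 (u1 u2 u3 v1 v2 v3 : S) :=
    a2 (u1 + u2) u3 v2 v3 * b1 u1 (v1 - v2)
    - a2 (u1 + u2) u3 v1 v3 * b1 u2 (v2 - v1)
    + a2 u1 (u2 + u3) v1 v3 * b1 u2 (v2 - v3)
    - a2 u1 (u2 + u3) v1 v2 * b1 u3 (v3 - v2)
    + a2 u1 u2 v1 v2 * b1 u3 v3
    + a1 u1 v1 * b2 u2 u3 v2 v3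
    + a1 (u1 + (u2 + u3)) v3 * b2 u1 u2 (v1 - v3) (v2 - v3)
    - a1 (u1 + (u2 + u3)) v1 * b2 u2 u3 (v2 - v1) (v3 - v1)
    + a1 (u1 + (u2 + u3)) v1 * (d u2 (v2 - v1) (v2 - v3) - d u3 (v3 - v1) (v3 - v2)).

(* On the arguments, the push (u1, u2; v1, v2) -> (-u1 - u2, u1; -v2, v1 - v2) is the fourth power
   of the composite of the swap with the exchange of the two letters. *)
Lemma b2_push (u1 u2 v1 v2 : S) : b2 u1 u2 v1 v2 =
  b2 (- (u1 + u2)) u1 (- v2) (v1 - v2)
  - d v1 (u1 + u2) u1 + d u1 v1 (v1 - v2) - d (v1 - v2) u1 (- u2) + d (- u2) (v1 - v2) (- v2).
Proof.
(* One round: a swap, then the exchange of the letters by the stuffle relation. Each round changes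
   the sign of [b2], so after four rounds it is positive and the divided differences have
   alternating signs. *)
have swap_stuffle x1 x2 y1 y2 :
    b2 x1 x2 y1 y2 = - b2 (y1 - y2) y2 x1 (x1 + x2) - d y1 (x1 + x2) x1.
  rewrite -(b2_swap x1); have := b2_stuffle y2 (y1 - y2) (x1 + x2) x1.
  by rewrite [y2 + _]addrC subrK => <-; ring.
have s2 : b2 (v1 - v2) v2 u1 (u1 + u2) = - b2 (- u2) (u1 + u2) (v1 - v2) v1 - d u1 v1 (v1 - v2).
  by rewrite swap_stuffle subrK opprD addNKr.
have s3 : b2 (- u2) (u1 + u2) (v1 - v2) v1 = - b2 (- v2) v1 (- u2) u1 - d (v1 - v2) u1 (- u2).
  by rewrite swap_stuffle [v1 - v2 - v1]addrAC subrr sub0r [- u2 + _]addrC addrK.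
have s4 : b2 (- v2) v1 (- u2) u1 = - b2 (- (u1 + u2)) u1 (- v2) (v1 - v2) - d (- u2) (v1 - v2) (- v2).
  by rewrite swap_stuffle opprD [- u2 - u1]addrC [- v2 + v1]addrC.
by rewrite swap_stuffle s2 s3 s4; ring.
Qed.

(** Among the products of [depth3], the swap exchanges the first with the fifth, the second with the
    fourth and the sixth with the seventh, and fixes the third. The eighth changes by a push, which
    the last product compensates. *)
Lemma depth3_swap (u1 u2 u3 v1 v2 v3 : S) :
  depth3 v3 (v2 - v3) (v1 - v2) (u1 + (u2 + u3)) (u1 + u2) u1 = depth3 u1 u2 u3 v1 v2 v3.
Proof.
(* The second and the fourth divided difference together are the bracket in [depth3]; the first and
   the third together are the negative of the swapped bracket, by [d_sym] and [dN]. *)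
have push : b2 u2 u3 (v2 - v1) (v3 - v1) = b2 (- (u2 + u3)) u2 (v1 - v3) (v2 - v3)
    - d (v2 - v1) (u2 + u3) u2 + d u2 (v2 - v1) (v2 - v3)
    - d (v2 - v3) u2 (- u3) - d u3 (v3 - v1) (v3 - v2).
  rewrite b2_push; have -> : v2 - v1 - (v3 - v1) = v2 - v3 by ring.
  by rewrite -(d_sym u3 (v3 - v1)) -(dN u3) !opprB.
rewrite /depth3 push.
have -> : v3 + (v2 - v3) = v2 by ring.
have -> : v2 - v3 + (v1 - v2) = v1 - v3 by ring.
have -> : v3 + (v1 - v3) = v1 by ring.
have -> : u1 + (u2 + u3) - (u1 + u2) = u3 by ring.
have -> : u1 + (u2 + u3) - u1 = u2 + u3 by ring.
have -> : u1 + u2 - (u1 + (u2 + u3)) = - u3 by ring.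
have -> : u1 + u2 - u1 = u2 by ring.
have -> : u1 - (u1 + u2) = - u2 by ring.
have -> : u1 - (u1 + (u2 + u3)) = - (u2 + u3) by ring.
have -> : b2 (v2 - v3) (v1 - v2) (u1 + u2) u1 = b2 u1 u2 (v1 - v3) (v2 - v3).
  by rewrite -(b2_swap u1); congr b2; ring.
have -> : b2 (v2 - v3) (v1 - v2) (- u3) (- (u2 + u3)) =
    b2 (- (u2 + u3)) u2 (v1 - v3) (v2 - v3).
  by rewrite -(b2_swap (- (u2 + u3))); congr b2; ring.
rewrite (b2_swap u2 u3) (a2_swap u1 u2) 2!(a2_swap u1 (u2 + u3)) (addrA u1) 2!(a2_swap (u1 + u2)).
rewrite (d_sym (v2 - v3)) -(opprB v2 v1) dN.
rewrite -(b1_even u2 (v2 - v1)) -(b1_even u3 (v3 - v2)) !opprB.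
rewrite (a1_swap u1) 2!(a1_swap (u1 + u2 + u3)) (b1_swap u3) (b1_swap (- u3)) (b1_swap u2).
by rewrite (b1_swap (- u2)) (b1_swap u1); ring.
Qed.
End SwapInvariance.

(** * The theorem, by cases on the depth *)

Lemma bari_il_swap_ev (R : comAlgType rat) (M : bimould R) n (w : word R n) :
  bari_il_swap M -> ev M (swapw w) = ev M w.
Proof. by case=> _ _ M_swap _; rewrite -ev_swap M_swap. Qed.

Theorem proposition2p51 (R : comAlgType rat) (A B : bimould R)
    (hA : bari_il_swap A) (hB : bari_il_swap B) (d : nat) :
  (1 <= d <= 3)%N -> swap (preuri A B) d = preuri A B d.
Proof.
move=> d_range; rewrite /swap -[RHS]ev_letters.
have [A_bari _ _ _] := hA; have [B_bari B_il _ B_even] := hB.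
have swap1 M n (u v : {mpoly R[n]}) : bari_il_swap M -> ev M [:: (v, u)] = ev M [:: (u, v)].
  by move=> hM; rewrite -(bari_il_swap_ev [:: (u, v)] hM) swapw1.
have swap2 M n (u1 u2 v1 v2 : {mpoly R[n]}) : bari_il_swap M ->
    ev M [:: (v2, u1 + u2); (v1 - v2, u1)] = ev M [:: (u1, v1); (u2, v2)].
  by move=> hM; rewrite -(bari_il_swap_ev [:: (u1, v1); (u2, v2)] hM) swapw2.
(* The explicit formulas hold for arbitrary entries, so the word of letters may be replaced by any
   word of length [d] and split according to its length. *)
move: (letters R d) (size_letters R d) => w size_w.
rewrite -size_w in d_range.
case: w d_range {size_w} => [|[u1 v1] [|[u2 v2] [|[u3 v3] [|? ?]]]]; first discriminate.
- by move=> _; rewrite swapw1 (ev_preuri1 v1 u1 A_bari B_bari) (ev_preuri1 u1 v1 A_bari B_bari).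
- move=> _; rewrite swapw2 (ev_preuri2 u1 u2 v1 v2 A_bari B_bari).
  rewrite (ev_preuri2 v2 (v1 - v2) (u1 + u2) u1 A_bari B_bari).
  apply: (@depth2_swap _ (fun u v => ev A [:: (u, v)]) (fun u v => ev B [:: (u, v)])) => *.
  - exact: swap1.
  - exact: swap1.
  exact: even1_ev.
- move=> _; rewrite swapw3 (ev_preuri3 u1 u2 u3 v1 v2 v3 A_bari B_bari B_il).
  rewrite (ev_preuri3 v3 (v2 - v3) (v1 - v2) (u1 + (u2 + u3)) (u1 + u2) u1 A_bari B_bari B_il).
  apply: (@depth3_swap _ (fun u v => ev A [:: (u, v)]) (fun u v => ev B [:: (u, v)])
    (fun u1 u2 v1 v2 => ev A [:: (u1, v1); (u2, v2)])
    (fun u1 u2 v1 v2 => ev B [:: (u1, v1); (u2, v2)])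
    _ _ _ _ _ (@ddiff R B (d + d))) => *.
  - exact: swap1.
  - exact: swap1.
  - exact: even1_ev.
  - exact: swap2.
  - exact: swap2.
  - exact: ddiff_sym.
  - exact: ddiffN.
  exact: alternil_stuffle.
discriminate.
Qed.
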